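(* Let $p\in(1,\infty)$, let $E$ be a Banach space, let $X$ be a $p$-convex Banach lattice and let $T\colon E\to X$ be an operator. There is a unique lattice homomorphism $\widehat T\colon\mathrm{FBL}_p[E]\to X$ such that $\widehat T\circ\phi_E=T$, and $\|\widehat T\|\le M^{(p)}(X)\,\|T\|$, where $M^{(p)}(X)$ denotes the $p$-convexity constant of $X$.
   Context: All vector spaces, Banach spaces and Banach lattices are real; ''operator'' means bounded linear operator, ''lattice homomorphism'' means linear lattice homomorphism, and a sublattice is a linear subspace closed under finite suprema and infima. A Banach lattice $X$ is $p$-convex if there is a constant $M\ge1$ such that $\bigl\|(\sum_{k=1}^m|x_k|^p)^{1/p}\bigr\|\le M(\sum_{k=1}^m\|x_k\|^p)^{1/p}$ for every $m\in\mathbb N$ and $x_1,\dots,x_m\in X$ (with the left-hand expression defined by the positively homogeneous continuous function calculus of Banach lattices); the least such $M$ is $M^{(p)}(X)$. $H[E]$ denotes the vector lattice (with pointwise operations) of all positively homogeneous functions $f\colon E^*\to\mathbb R$. For $f\in H[E]$ define $$\|f\|_p=\sup\Bigl\{\Bigl(\sum_{k=1}^n|f(x_k^* )|^p\Bigr)^{1/p} : n\in\mathbb N,\ x_1^*,\dots,x_n^*\in E^*,\ \sup_{x\in B_E}\sum_{k=1}^n|x_k^*(x)|^p\le1\Bigr\},$$ where $B_E$ is the closed unit ball of $E$. The set $H_p[E]=\{f\in H[E] : \|f\|_p<\infty\}$ is a sublattice of $H[E]$ and a Banach lattice under $\|\cdot\|_p$. For $x\in E$ let $\delta_x\in H[E]$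 be $\delta_x(x^* )=x^*(x)$; then $\|\delta_x\|_p=\|x\|$. $\mathrm{FBL}_p[E]$ is the closure in $H_p[E]$ of the sublattice generated by $\{\delta_x : x\in E\}$, normed by $\|\cdot\|_p$, and $\phi_E\colon E\to\mathrm{FBL}_p[E]$ is the linear isometry $\phi_E(x)=\delta_x$. *)

(* Defs.v *)
From HB Require Import structures.
From mathcomp Require Import all_boot all_order all_algebra.
From mathcomp Require Import all_classical all_reals all_analysis.
From mathcomp Require Import lra.

Set Implicit Arguments.
Unset Strict Implicit.
Unset Printing Implicit Defensive.

Import Order.TTheory GRing.Theory Num.Theory numFieldNormedType.Exports.

Local Open Scope classical_set_scope.
Local Open Scope ring_scope.

(** * Vector lattices and Banach lattices *)

(* [Order.Lattice] cannot be reused: Hierarchy Builder rejects its join with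
   [GRing.Zmodule] because [realDomainType] already inherits from both. *)
HB.mixin Record isVectorLattice (R : realType) V & GRing.Lmodule R V := {
  vle : rel V ;
  vmeet : V -> V -> V ;
  vjoin : V -> V -> V ;
  vle_refl : reflexive vle ;
  vle_anti : antisymmetric vle ;
  vle_trans : transitive vle ;
  vle_meet : forall x y z, vle x (vmeet y z) = vle x y && vle x z ;
  vjoin_le : forall x y z, vle (vjoin x y) z = vle x z && vle y z ;
  vle_add2r : forall z x y, vle x y -> vle (x + z) (y + z) ;
  vle_scale : forall (a : R) x y, 0 <= a -> vle x y -> vle (a *: x) (a *: y)
}.

#[short(type="vectorLatticeType")]
HB.structure Definition VectorLattice (R : realType) :=
  { V of GRing.Lmodule R V & isVectorLattice R V }.

Definition vabs (R : realType) (V : vectorLatticeType R) (x : V) : V :=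
  vjoin x (- x).

HB.mixin Record isNormedLattice (R : realType) V
    & VectorLattice R V & NormedModule R V := {
  vle_norm : forall x y : V, vle (vabs x) (vabs y) -> `|x| <= `|y|
}.

#[short(type="normedLatticeType")]
HB.structure Definition NormedLattice (R : realType) :=
  { V of VectorLattice R V & NormedModule R V & isNormedLattice R V }.

#[short(type="banachLatticeType")]
HB.structure Definition BanachLattice (R : realType) :=
  { V of NormedLattice R V & Complete V }.

Definition lattice_hom (R : realType) (V W : vectorLatticeType R)
    (f : V -> W) : Prop :=
  [/\ linear f, {morph f : x y / vmeet x y} & {morph f : x y / vjoin x y}].

Definition sublattice (R : realType) (V : vectorLatticeType R)
    (S : set V) : Prop :=
  [/\ S 0, forall (a : R) x y, S x -> S y -> S (a *: x + y),
      forall x y, S x -> S y -> S (vmeet x y) &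
      forall x y, S x -> S y -> S (vjoin x y)].

(* The value is an extended real, [+oo] exactly when [f] is unbounded on the
   unit ball. *)
Definition opnorm (R : realType) (V W : normedModType R) (f : V -> W) : \bar R :=
  ereal_sup [set `|f x|%:E | x in [set x : V | `|x| <= 1]].

Section FunctionLattice.
Context (T : Type) (R : realType).
Implicit Types f g h : T -> R.

Definition fun_vle f g : bool := `[< forall t, f t <= g t >].
Definition fun_vmeet f g : T -> R := fun t => Num.min (f t) (g t).
Definition fun_vjoin f g : T -> R := fun t => Num.max (f t) (g t).

Lemma fun_vle_refl : reflexive fun_vle.
Proof. by move=> f; apply/asboolP. Qed.

Lemma fun_vle_anti : antisymmetric fun_vle.
Proof.
move=> f g /andP[/asboolP fg /asboolP gf]; apply/funext => t.
by apply/eqP; rewrite eq_le fg gf.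
Qed.

Lemma fun_vle_trans : transitive fun_vle.
Proof.
move=> g f h /asboolP fg /asboolP gh; apply/asboolP => t.
exact: le_trans (fg t) (gh t).
Qed.

Lemma fun_vle_meet f g h : fun_vle f (fun_vmeet g h) = fun_vle f g && fun_vle f h.
Proof.
apply/asboolP/andP => [fgh|[/asboolP fg /asboolP fh] t].
  by split; apply/asboolP => t; have := fgh t; rewrite le_min => /andP[].
by rewrite le_min fg fh.
Qed.

Lemma fun_vjoin_le f g h : fun_vle (fun_vjoin f g) h = fun_vle f h && fun_vle g h.
Proof.
apply/asboolP/andP => [fgh|[/asboolP fh /asboolP gh] t].
  by split; apply/asboolP => t; have := fgh t; rewrite ge_max => /andP[].
by rewrite ge_max fh gh.
Qed.

Lemma fun_vle_add2r h f g : fun_vle f g -> fun_vle (f + h) (g + h).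
Proof. by move=> /asboolP fg; apply/asboolP => t; rewrite lerD2r. Qed.

Lemma fun_vle_scale (a : R) f g :
  0 <= a -> fun_vle f g -> fun_vle (a *: f) (a *: g).
Proof. by move=> a0 /asboolP fg; apply/asboolP => t; rewrite ler_wpM2l. Qed.

HB.instance Definition _ := isVectorLattice.Build R (T -> R)
  fun_vle_refl fun_vle_anti fun_vle_trans fun_vle_meet fun_vjoin_le
  fun_vle_add2r fun_vle_scale.

End FunctionLattice.

(** * Functional calculus and p-convexity *)

Definition pos_homog (R : realType) (V : lmodType R) (h : V -> R) : Prop :=
  forall (a : R) v, 0 <= a -> h (a *: v) = a * h v.

Definition lp_sum (R : realType) (p : R) (m : nat) (t : 'I_m -> R) : R :=
  (\sum_(k < m) `|t k| `^ p) `^ p^-1.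

Section FunctionCalculus.
Context (R : realType) (X : banachLatticeType R) (m : nat).

Definition calc_fun (h : 'rV[R]_m -> R) : Prop := continuous h /\ pos_homog h.

(* By Krivine's theorem every tuple [x] has exactly one such map, up to its
   irrelevant values outside [calc_fun]. *)
Definition is_calculus (x : 'I_m -> X) (Phi : ('rV[R]_m -> R) -> X) : Prop :=
  [/\ forall (a : R) g h, calc_fun g -> calc_fun h ->
        Phi (a *: g + h) = a *: Phi g + Phi h,
      forall g h, calc_fun g -> calc_fun h ->
        Phi (vmeet g h) = vmeet (Phi g) (Phi h),
      forall g h, calc_fun g -> calc_fun h ->
        Phi (vjoin g h) = vjoin (Phi g) (Phi h) &
      forall i, Phi (fun t => t 0 i) = x i].

Definition calculus (x : 'I_m -> X) : ('rV[R]_m -> R) -> X :=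
  xget (fun=> 0) [set Phi | is_calculus x Phi].

End FunctionCalculus.

Section PConvexity.
Context (R : realType) (p : R) (X : banachLatticeType R).

Definition p_convexity_bound (M : R) : Prop :=
  1 <= M /\ forall (m : nat) (x : 'I_m -> X),
    `|calculus x (fun t => lp_sum p (t 0))| <= M * lp_sum p (fun k => `|x k|).

Definition p_convex : Prop := exists M, p_convexity_bound M.

Definition p_convexity_constant : R := inf [set M | p_convexity_bound M].

End PConvexity.

(** * The dual space *)

Section Dual.
Context (R : realType) (E : normedModType R).

Definition dual_set : set (E -> R) := [set f | linear f /\ continuous f].

Definition dual_pred : {pred E -> R} := mem dual_set.

Definition dualSpace : Type := {f : E -> R | f \in dual_pred}.
HB.instance Definition _ := SubType.on dualSpace.
HB.instance Definition _ := Choice.on dualSpace.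

Definition dual_app (f : dualSpace) : E -> R := val f.
Coercion dual_app : dualSpace >-> Funclass.

Lemma dual_app_linear (f : dualSpace) : linear (dual_app f).
Proof. by have /set_mem[] := valP f. Qed.

Lemma dual_app_continuous (f : dualSpace) : continuous (dual_app f).
Proof. by have /set_mem[] := valP f. Qed.

HB.instance Definition _ (f : dualSpace) :=
  GRing.isLinear.Build R E R *:%R (dual_app f) (@dual_app_linear f).

Lemma dual_submod : subsemimod_closed dual_pred.
Proof.
split; first split.
- apply/mem_set; split => [a x y|]; first by rewrite scaler0 addr0.
  exact: cst_continuous.
- move=> f g /set_mem[fl fc] /set_mem[gl gc]; apply/mem_set; split.
    by move=> a x y; rewrite !fctE fl gl scalerDr addrACA.
  by move=> x; exact: (@continuousD R R^o E f g x (fc x) (gc x)).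
- move=> a f /set_mem[fl fc]; apply/mem_set; split.
    by move=> b x y; rewrite !fctE fl scalerDr !scalerA (mulrC a).
  by move=> x; exact: (@continuousZl_tmp R R^o E f a x (fc x)).
Qed.

HB.instance Definition _ :=
  GRing.SubChoice_isSubLmodule.Build R (E -> R) dual_pred dualSpace dual_submod.

End Dual.

(** * The free p-convex Banach lattice *)

Section LpSum.
Context (R : realType) (p : R) (p1 : 1 < p) (m : nat).
Implicit Types s t : 'I_m -> R.

Let p0 : 0 < p. Proof. exact: lt_trans p1. Qed.
Let pN0 : p != 0. Proof. by rewrite gt_eqF. Qed.

Lemma lp_sum_ge0 t : 0 <= lp_sum p t.
Proof. exact: powR_ge0. Qed.

Let sum_ge0 t : 0 <= \sum_k `|t k| `^ p.
Proof. by apply: sumr_ge0 => k _; exact: powR_ge0. Qed.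

Lemma lp_sum_pow t : lp_sum p t `^ p = \sum_k `|t k| `^ p.
Proof. by rewrite /lp_sum -powRrM mulVf// powRr1. Qed.

Lemma lp_sum_le s t : (forall k, `|s k| <= `|t k|) -> lp_sum p s <= lp_sum p t.
Proof.
move=> st; apply: ge0_ler_powR; rewrite ?nnegrE ?invr_ge0 ?(ltW p0)//.
by apply: ler_sum => k _; apply: ge0_ler_powR; rewrite ?nnegrE ?(ltW p0).
Qed.

Lemma lp_sumZ (a : R) t : lp_sum p (fun k => a * t k) = `|a| * lp_sum p t.
Proof.
rewrite /lp_sum.
under eq_bigr do rewrite normrM powRM//.
by rewrite -mulr_sumr powRM ?powR_ge0// -powRrM mulfV// powRr1.
Qed.

Lemma lp_sum_eq0 t k : lp_sum p t = 0 -> t k = 0.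
Proof.
move=> t0; have /esym/eqP := lp_sum_pow t; rewrite t0 powR0//.
rewrite psumr_eq0 => [/allP/(_ k)|i _]; last exact: powR_ge0.
by rewrite mem_index_enum powR_eq0 pN0 andbT normr_eq0 => /(_ isT)/eqP.
Qed.

Lemma lp_sum_coord t k : `|t k| <= lp_sum p t.
Proof.
rewrite -[leLHS]powRr1// -(mulfV pN0) powRrM.
apply: ge0_ler_powR; rewrite ?nnegrE ?invr_ge0 ?(ltW p0) ?powR_ge0//.
rewrite (bigD1 k)//= lerDl; apply: sumr_ge0 => i _; exact: powR_ge0.
Qed.

Lemma lp_sumD s t :
  lp_sum p (fun k => s k + t k) <= lp_sum p s + lp_sum p t.
Proof.
have [s0|sN0] := eqVneq (lp_sum p s) 0.
  rewrite s0 add0r; apply: lp_sum_le => k.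
  by rewrite (lp_sum_eq0 k s0) add0r.
have [t0|tN0] := eqVneq (lp_sum p t) 0.
  rewrite t0 addr0; apply: lp_sum_le => k.
  by rewrite (lp_sum_eq0 k t0) addr0.
have : 0 < lp_sum p s by rewrite lt_def sN0 lp_sum_ge0.
have : 0 < lp_sum p t by rewrite lt_def tN0 lp_sum_ge0.
have sum1 t' : 0 < lp_sum p t' -> \sum_k (`|t' k| / lp_sum p t') `^ p = 1.
  move=> t'0; under eq_bigr do rewrite powRM ?invr_ge0 ?(ltW t'0)//.
  rewrite -mulr_suml -lp_sum_pow -powRM ?invr_ge0 ?(ltW t'0)//.
  by rewrite divff ?gt_eqF// powR1.
move: (sum1 s) (sum1 t).
move: (lp_sum p s) (lp_sum p t) => A B {sN0 tN0} sumA sumB B0 A0.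
have AB0 : 0 < A + B by rewrite addr_gt0.
have w0 : 0 <= A / (A + B) by rewrite divr_ge0// ltW.
have w1 : A / (A + B) <= 1 by rewrite ler_pdivrMr// mul1r lerDl ltW.
have wE : 1 - A / (A + B) = B / (A + B).
  by apply/eqP; rewrite subr_eq -mulrDl addrC divff// gt_eqF.
rewrite -[leRHS](powRr1 (ltW AB0)) -(mulfV pN0) powRrM.
apply: ge0_ler_powR; rewrite ?nnegrE ?invr_ge0 ?(ltW p0) ?powR_ge0//.
suff le_k k : `|s k + t k| `^ p <= (A + B) `^ p *
    (A / (A + B) * (`|s k| / A) `^ p + B / (A + B) * (`|t k| / B) `^ p).
  apply: (le_trans (ler_sum _ (fun k _ => le_k k))).
  rewrite -mulr_sumr big_split/= -!mulr_sumr sumA// sumB//.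
  by rewrite !mulr1 -mulrDl divff ?gt_eqF// mulr1.
have -> : `|s k + t k| `^ p =
    (A + B) `^ p * (`|s k + t k| / (A + B)) `^ p.
  rewrite -powRM ?divr_ge0 ?(ltW AB0)//.
  by rewrite mulrCA divff ?gt_eqF// mulr1.
rewrite ler_wpM2l ?powR_ge0//.
have := @convex_powR R p (ltW p1) (Itv01 w0 w1) (`|s k| / A) (`|t k| / B).
rewrite !inE/= !in_itv/= !andbT !divr_ge0 ?(ltW A0) ?(ltW B0)//.
move=> /(_ isT isT).
rewrite convRE [X in X `^ _ <= _]convRE /= /unstable.onem wE; apply: le_trans.
apply: ge0_ler_powR; rewrite ?nnegrE ?(ltW p0)//.
- by rewrite divr_ge0// ltW.
- by apply: addr_ge0; apply: mulr_ge0; rewrite // divr_ge0// ltW.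
have cancel c x : 0 < c -> c / (A + B) * (x / c) = x / (A + B).
  by move=> c0; rewrite mulrC mulrA divfK// gt_eqF.
rewrite !cancel// -mulrDl ler_wpM2r ?ler_normD// invr_ge0.
exact: ltW.
Qed.

End LpSum.

Lemma le_norm_minB (R : realType) (a b c d : R) :
  `|Num.min a b - Num.min c d| <= `|a - c| + `|b - d|.
Proof.
have := ler_norm (a - c); have := ler_norm (- (a - c)).
have := ler_norm (b - d); have := ler_norm (- (b - d)); rewrite !normrN.
by rewrite ler_norml; case: (leP a b); case: (leP c d); lra.
Qed.

Lemma le_norm_maxB (R : realType) (a b c d : R) :
  `|Num.max a b - Num.max c d| <= `|a - c| + `|b - d|.
Proof.
have := ler_norm (a - c); have := ler_norm (- (a - c)).
have := ler_norm (b - d); have := ler_norm (- (b - d)); rewrite !normrN.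
by rewrite ler_norml; case: (leP a b); case: (leP c d); lra.
Qed.

Section FBL.
Context (R : realType) (p : R) (E : normedModType R).
Implicit Types f g : dualSpace E -> R.

(* The supremum over the unit ball of the sums is at most [1]. *)
Definition weak_lp_le1 (n : nat) (xs : 'I_n -> dualSpace E) : Prop :=
  forall x : E, `|x| <= 1 -> \sum_(k < n) `|xs k x| `^ p <= 1.

(* The supremum is taken in the extended reals: it is [+oo] when the norm is
   not finite. *)
Definition Hp_norm f : \bar R :=
  ereal_sup [set s | exists n (xs : 'I_n -> dualSpace E),
    weak_lp_le1 xs /\ s = (lp_sum p (fun k => f (xs k)))%:E].

Definition Hp : set (dualSpace E -> R) :=
  [set f | pos_homog f /\ (Hp_norm f < +oo)%E].

Definition delta (x : E) : dualSpace E -> R := fun y => y x.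

(* The sublattice is generated in the vector lattice of all functions on the
   dual, of which [H[E]] is a sublattice containing every [delta x]. *)
Definition FBL_gen : set (dualSpace E -> R) :=
  smallest (@sublattice R (dualSpace E -> R)) (range delta).

Definition FBL_set : set (dualSpace E -> R) :=
  [set f | Hp f /\ forall e : R, 0 < e ->
    exists2 g, FBL_gen g & (Hp_norm (f - g)%R < e%:E)%E].

Context (p1 : 1 < p).

Let p0 : 0 < p. Proof. exact: lt_trans p1. Qed.

Lemma Hp_norm_ge f n (xs : 'I_n -> dualSpace E) : weak_lp_le1 xs ->
  ((lp_sum p (fun k => f (xs k)))%:E <= Hp_norm f)%E.
Proof. by move=> wxs; apply: ereal_sup_ubound; exists n, xs. Qed.

Lemma Hp_norm_le f (c : \bar R) :
  (forall n (xs : 'I_n -> dualSpace E), weak_lp_le1 xs ->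
    ((lp_sum p (fun k => f (xs k)))%:E <= c)%E) -> (Hp_norm f <= c)%E.
Proof. by move=> fc; apply: ge_ereal_sup => _ [n [xs [wxs ->]]]; exact: fc. Qed.

Lemma Hp_norm_ge0 f : (0 <= Hp_norm f)%E.
Proof.
have w0 : weak_lp_le1 (fun _ : 'I_0 => 0%R) by move=> x _; rewrite big_ord0.
by apply: le_trans (Hp_norm_ge f w0); rewrite lee_fin lp_sum_ge0.
Qed.

Lemma Hp_norm_mono f g : (forall y, `|f y| <= `|g y|) ->
  (Hp_norm f <= Hp_norm g)%E.
Proof.
move=> fg; apply: Hp_norm_le => n xs wxs.
by apply: le_trans (Hp_norm_ge g wxs); rewrite lee_fin lp_sum_le.
Qed.

Lemma Hp_normD f g : (Hp_norm (f + g)%R <= Hp_norm f + Hp_norm g)%E.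
Proof.
apply: Hp_norm_le => n xs wxs.
apply: le_trans (leeD (Hp_norm_ge f wxs) (Hp_norm_ge g wxs)).
by rewrite -EFinD lee_fin lp_sumD.
Qed.

Lemma Hp_normZ (a : R) f : Hp_norm (a *: f) = (`|a|%:E * Hp_norm f)%E.
Proof.
have le_Z b g : (Hp_norm (b *: g) <= `|b|%:E * Hp_norm g)%E.
  apply: Hp_norm_le => n xs wxs.
  by rewrite [lp_sum _ _]lp_sumZ// EFinM lee_wpmul2l ?lee_fin// Hp_norm_ge.
apply/eqP; rewrite eq_le le_Z/=.
have [->|a0] := eqVneq a 0; first by rewrite normr0 mul0e Hp_norm_ge0.
have {1}-> : f = a^-1 *: (a *: f) by rewrite scalerA mulVf// scale1r.
apply: (le_trans (lee_wpmul2l _ (le_Z a^-1 (a *: f)))); first by rewrite lee_fin.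
by rewrite muleA -EFinM -normrM divff// normr1 mul1e.
Qed.

Lemma Hp_norm0 : Hp_norm 0 = 0%E.
Proof. by rewrite -(scale0r 0) Hp_normZ normr0 mul0e. Qed.

Lemma dual_bound (y : dualSpace E) :
  exists2 c : R, 0 < c & forall x, `|y x| <= c * `|x|.
Proof.
have /linear_bounded_continuous/linear_boundedP := @dual_app_continuous _ _ y.
by move=> /pinfty_ex_gt0[c c0 yc]; exists c.
Qed.

Lemma weak_lp1 (y : dualSpace E) : (forall x, `|y x| <= `|x|) ->
  weak_lp_le1 (fun _ : 'I_1 => y).
Proof.
move=> yle x x1; rewrite big_ord1; have <- : 1 `^ p = 1 :> R by rewrite powR1.
by apply: ge0_ler_powR; rewrite ?nnegrE ?(ltW p0)// (le_trans (yle x)).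
Qed.

Lemma Hp_norm_eq0 f : pos_homog f -> Hp_norm f = 0%E -> f = 0.
Proof.
move=> fh f0; apply/funext => y; have [c c0 yc] := dual_bound y.
have w : weak_lp_le1 (fun _ : 'I_1 => c^-1 *: y).
  apply: weak_lp1 => x; rewrite (_ : _ x = c^-1 * y x)//.
  by rewrite normrM gtr0_norm ?invr_gt0// ler_pdivrMl.
have := Hp_norm_ge f w; rewrite f0 lee_fin => lp0.
have {}lp0 : lp_sum p (fun _ : 'I_1 => f (c^-1 *: y)) = 0.
  by apply/eqP; rewrite eq_le lp0 lp_sum_ge0.
have := lp_sum_eq0 p1 ord0 lp0; rewrite fh ?invr_ge0 ?(ltW c0)// => /eqP.
by rewrite mulf_eq0 invr_eq0 gt_eqF//= => /eqP.
Qed.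

Lemma Hp_norm_delta (x : E) : (Hp_norm (delta x) <= `|x|%:E)%E.
Proof.
have scale_le1 n (xs : 'I_n -> dualSpace E) (u : E) :
    weak_lp_le1 xs -> `|u| <= 1 -> lp_sum p (fun k => xs k u) <= 1.
  move=> wxs u1; have <- : 1 `^ p^-1 = 1 :> R by rewrite powR1.
  apply: ge0_ler_powR; rewrite ?nnegrE ?invr_ge0 ?(ltW p0)// ?wxs//.
  by apply: sumr_ge0 => k _; exact: powR_ge0.
apply: Hp_norm_le => n xs wxs; rewrite lee_fin.
have [->|x0] := eqVneq x 0.
  rewrite normr0 (_ : (fun k => _) = fun k => 0 * xs k 0); last first.
    by apply/funext => k; rewrite /delta linear0 mul0r.
  by rewrite lp_sumZ// normr0 mul0r.
have nx0 : 0 < `|x| by rewrite normr_gt0.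
rewrite (_ : (fun k => _) = fun k => `|x| * xs k (`|x|^-1 *: x)); last first.
  by apply/funext => k; rewrite /delta linearZ/= mulrA divff ?mul1r// gt_eqF.
rewrite lp_sumZ// normr_id ler_piMr// scale_le1//.
by rewrite normrZ normfV normr_id mulVf// gt_eqF.
Qed.

Lemma Hp_normB f g : Hp_norm (f - g)%R = Hp_norm (g - f)%R.
Proof. by rewrite -opprB -scaleN1r Hp_normZ normrN1 mul1e. Qed.

Lemma Hp_norm_comb (a : R) f g h :
  (forall y, `|h y| <= `|a| * `|f y| + `|g y|) ->
  (Hp_norm h <= `|a|%:E * Hp_norm f + Hp_norm g)%E.
Proof.
move=> le_h.
have abs_le k : (Hp_norm (fun y => `|k y|%R) <= Hp_norm k)%E.
  by apply: Hp_norm_mono => y; rewrite normr_id.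
apply: (@le_trans _ _
    (Hp_norm (`|a| *: (fun y => `|f y|) + (fun y => `|g y|)))).
  apply: Hp_norm_mono => y; rewrite [X in _ <= X]ger0_norm ?le_h//.
  by rewrite addr_ge0// mulr_ge0.
apply: (le_trans (Hp_normD _ _)); rewrite Hp_normZ normr_id.
apply: leeD; last exact: abs_le.
by apply: lee_wpmul2l; [rewrite lee_fin|exact: abs_le].
Qed.

Lemma FBL_gen_sublattice : sublattice FBL_gen.
Proof.
split=> [S [[]]//|a x y xS yS S SG|x y xS yS S SG|x y xS yS S SG];
  have := xS _ SG; have := yS _ SG; case: SG => -[_ SD SI SU] _ Sy Sx.
- exact: SD.
- exact: SI.
- exact: SU.
Qed.

Lemma FBL_set_op (a : R) f f' h : FBL_set f -> FBL_set f' -> pos_homog h ->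
  (forall y, `|h y| <= `|a| * `|f y| + `|f' y|) ->
  (forall g g', FBL_gen g -> FBL_gen g' -> exists2 k, FBL_gen k &
    forall y, `|h y - k y| <= `|a| * `|f y - g y| + `|f' y - g' y|) ->
  FBL_set h.
Proof.
move=> [[_ ffin] fapprox] [[_ f'fin] f'approx] hh hle happrox.
split; first (split; first exact: hh).
  apply: (le_lt_trans (Hp_norm_comb hle)); apply: lte_add_pinfty; last exact: f'fin.
  by apply: lte_mul_pinfty; [rewrite lee_fin|exact: fin_numE|exact: ffin].
move=> e e0.
have c0 : 0 < 2 * (`|a| + 1) by rewrite mulr_gt0// ltr_wpDl.
have [g gG gf] := fapprox _ (divr_gt0 e0 c0).
have e20 : 0 < e / 2 by rewrite divr_gt0.
have [g' g'G g'f] := f'approx _ e20.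
have [k kG kle] := happrox _ _ gG g'G; exists k; first exact: kG.
have hk y : `|(h - k) y| <= `|a| * `|(f - g) y| + `|(f' - g') y| by exact: kle.
apply: (le_lt_trans (Hp_norm_comb hk)).
have := Hp_norm_ge0 (f - g); have := Hp_norm_ge0 (f' - g').
case: (Hp_norm (f' - g')) g'f => // n' + _.
case: (Hp_norm (f - g)) gf => // n nlt n'lt n0.
rewrite -EFinM -EFinD !lte_fin lee_fin in nlt n'lt n0 *.
rewrite ltr_pdivlMr// in nlt; rewrite (splitr e); apply: ler_ltD n'lt.
rewrite ler_pdivlMr//; move: n0 nlt; move: (`|a|) => b n0 nlt.
by lra.
Qed.

Lemma pos_homog_vmeet f g : pos_homog f -> pos_homog g -> pos_homog (vmeet f g).
Proof.
move=> fh gh a v a0; rewrite /vmeet/= /fun_vmeet fh// gh//.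
by rewrite minr_pMr.
Qed.

Lemma pos_homog_vjoin f g : pos_homog f -> pos_homog g -> pos_homog (vjoin f g).
Proof.
move=> fh gh a v a0; rewrite /vjoin/= /fun_vjoin fh// gh//.
by rewrite maxr_pMr.
Qed.

Lemma FBL_set_sublattice : sublattice FBL_set.
Proof.
have [G0 GD GI GU] := FBL_gen_sublattice.
split.
- split; first by split=> [a v a0|]; rewrite ?mulr0// Hp_norm0.
  by move=> e e0; exists 0; rewrite ?subrr ?Hp_norm0.
- move=> a f g Ff Fg; apply: (FBL_set_op (a := a) Ff Fg).
  + move=> b v b0; have [[fh _] _] := Ff; have [[gh _] _] := Fg.
    rewrite (_ : _ (b *: v) = a * f (b *: v) + g (b *: v))//.
    by rewrite fh// gh// mulrCA -mulrDr.
  + by move=> y; rewrite -normrM; exact: ler_normD.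
  + move=> g1 g2 G1 G2; exists (a *: g1 + g2); first exact: GD.
    move=> y; rewrite -normrM.
    have -> : (a *: f + g) y - (a *: g1 + g2) y =
      a * (f y - g1 y) + (g y - g2 y).
      by rewrite mulrBr addrACA -opprD.
    exact: ler_normD.
- move=> f g Ff Fg; apply: (FBL_set_op (a := 1) Ff Fg).
  + by apply: pos_homog_vmeet; [case: Ff => -[]|case: Fg => -[]].
  + move=> y; rewrite normr1 mul1r.
    by have := le_norm_minB (f y) (g y) 0 0; rewrite minxx !subr0.
  + move=> g1 g2 G1 G2; exists (vmeet g1 g2); first exact: GI.
    by move=> y; rewrite normr1 mul1r; exact: le_norm_minB.
- move=> f g Ff Fg; apply: (FBL_set_op (a := 1) Ff Fg).
  + by apply: pos_homog_vjoin; [case: Ff => -[]|case: Fg => -[]].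
  + move=> y; rewrite normr1 mul1r.
    by have := le_norm_maxB (f y) (g y) 0 0; rewrite maxxx !subr0.
  + move=> g1 g2 G1 G2; exists (vjoin g1 g2); first exact: GU.
    by move=> y; rewrite normr1 mul1r; exact: le_norm_maxB.
Qed.

End FBL.

Section FBLSpace.
Context (R : realType) (p : R).

Definition FBL_pred (E : normedModType R) : {pred dualSpace E -> R} :=
  mem (@FBL_set R p E).

(* The proof of [1 < p] is used only by the instances below, for the triangle
   inequality. *)
Definition FBL of 1 < p := fun E : normedModType R =>
  {f : dualSpace E -> R | f \in @FBL_pred E}.

Context (p1 : 1 < p) (E : normedModType R).

HB.instance Definition _ := SubType.on (FBL p1 E).
HB.instance Definition _ := Choice.on (FBL p1 E).

Lemma FBL_submod : subsemimod_closed (@FBL_pred E).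
Proof.
have [F0 FD _ _] := @FBL_set_sublattice R p E p1.
split; first split.
- exact/mem_set.
- move=> f g /set_mem Ff /set_mem Fg; apply/mem_set.
  by rewrite -(scale1r f); exact: (FD 1 f g Ff Fg).
- move=> a f /set_mem Ff; apply/mem_set.
  by rewrite -(addr0 (a *: f)); exact: (FD a f 0 Ff F0).
Qed.

HB.instance Definition _ := GRing.SubChoice_isSubLmodule.Build R
  (dualSpace E -> R) (@FBL_pred E) (FBL p1 E) FBL_submod.

Lemma FBL_meet_subproof (f g : FBL p1 E) : vmeet (val f) (val g) \in @FBL_pred E.
Proof.
have [_ _ FI _] := @FBL_set_sublattice R p E p1.
by apply/mem_set/FI; apply/set_mem; exact: valP.
Qed.

Lemma FBL_join_subproof (f g : FBL p1 E) : vjoin (val f) (val g) \in @FBL_pred E.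
Proof.
have [_ _ _ FU] := @FBL_set_sublattice R p E p1.
by apply/mem_set/FU; apply/set_mem; exact: valP.
Qed.

Definition FBL_le (f g : FBL p1 E) : bool := vle (val f) (val g).
Definition FBL_meet (f g : FBL p1 E) : FBL p1 E :=
  exist (fun h => h \in @FBL_pred E) _ (FBL_meet_subproof f g).
Definition FBL_join (f g : FBL p1 E) : FBL p1 E :=
  exist (fun h => h \in @FBL_pred E) _ (FBL_join_subproof f g).

Lemma FBL_le_refl : reflexive FBL_le.
Proof. by move=> f; exact: vle_refl. Qed.

Lemma FBL_le_anti : antisymmetric FBL_le.
Proof. by move=> f g fg; apply/val_inj/vle_anti. Qed.

Lemma FBL_le_trans : transitive FBL_le.
Proof. by move=> g f h; exact: vle_trans. Qed.

Lemma FBL_le_meet (f g h : FBL p1 E) :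
  FBL_le f (FBL_meet g h) = FBL_le f g && FBL_le f h.
Proof. by rewrite /FBL_le vle_meet. Qed.

Lemma FBL_join_le (f g h : FBL p1 E) :
  FBL_le (FBL_join f g) h = FBL_le f h && FBL_le g h.
Proof. by rewrite /FBL_le vjoin_le. Qed.

Lemma FBL_le_add2r (h f g : FBL p1 E) : FBL_le f g -> FBL_le (f + h) (g + h).
Proof. by rewrite /FBL_le !raddfD; exact: vle_add2r. Qed.

Lemma FBL_le_scale (a : R) (f g : FBL p1 E) :
  0 <= a -> FBL_le f g -> FBL_le (a *: f) (a *: g).
Proof. by rewrite /FBL_le !linearZ/=; exact: vle_scale. Qed.

HB.instance Definition _ := isVectorLattice.Build R (FBL p1 E)
  FBL_le_refl FBL_le_anti FBL_le_trans FBL_le_meet FBL_join_le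
  FBL_le_add2r FBL_le_scale.

Definition FBL_norm (f : FBL p1 E) : R := fine (Hp_norm p (val f)).

Lemma FBL_normE (f : FBL p1 E) : (FBL_norm f)%:E = Hp_norm p (val f).
Proof.
have /set_mem[[_ ffin] _] := valP f.
by rewrite /FBL_norm fineK// ge0_fin_numE// Hp_norm_ge0.
Qed.

Lemma FBL_normD (f g : FBL p1 E) : FBL_norm (f + g) <= FBL_norm f + FBL_norm g.
Proof.
have : (Hp_norm p (val (f + g)%R) <= Hp_norm p (val f) + Hp_norm p (val g))%E.
  exact: Hp_normD.
by rewrite -(FBL_normE (f + g)) -(FBL_normE f) -(FBL_normE g) -EFinD lee_fin.
Qed.

Lemma FBL_normZ (a : R) (f : FBL p1 E) : FBL_norm (a *: f) = `|a| * FBL_norm f.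
Proof.
have : Hp_norm p (val (a *: f)) = (`|a|%:E * Hp_norm p (val f))%E.
  exact: Hp_normZ.
by rewrite -(FBL_normE (a *: f)) -(FBL_normE f) -EFinM => -[].
Qed.

Lemma FBL_norm_eq0 (f : FBL p1 E) : FBL_norm f = 0 -> f = 0.
Proof.
move=> f0; have /set_mem[[fh _] _] := valP f.
by apply: val_inj; apply: (Hp_norm_eq0 p1 fh); rewrite -FBL_normE f0.
Qed.

HB.instance Definition _ := Lmodule_isNormed.Build R (FBL p1 E)
  FBL_normD FBL_normZ FBL_norm_eq0.

Lemma FBL_le_norm (f g : FBL p1 E) : vle (vabs f) (vabs g) -> `|f| <= `|g|.
Proof.
move=> /asboolP fg.
have : (Hp_norm p (val f) <= Hp_norm p (val g))%E.
  apply: Hp_norm_mono; first exact: p1.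
  move=> y; have := fg y.
  rewrite (_ : val (vabs f) y = Num.max (val f y) (- val f y))//.
  by rewrite (_ : val (vabs g) y = Num.max (val g y) (- val g y))// !maxrN.
by rewrite -(FBL_normE f) -(FBL_normE g) lee_fin.
Qed.

HB.instance Definition _ := isNormedLattice.Build R (FBL p1 E) FBL_le_norm.

Lemma FBL_delta_subproof (x : E) : delta x \in @FBL_pred E.
Proof.
apply/mem_set; split; first split.
- by move=> a y _.
- exact: le_lt_trans (Hp_norm_delta p1 x) (ltry _).
- move=> e e0; exists (delta x); last by rewrite subrr Hp_norm0.
  by move=> S [_ SG]; apply: SG; exists x.
Qed.

Definition FBL_delta (x : E) : FBL p1 E :=
  exist (fun h => h \in @FBL_pred E) _ (FBL_delta_subproof x).

End FBLSpace.

Section FBLComplete.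
Context (R : realType) (p : R) (p1 : 1 < p) (E : normedModType R).

Let p0 : 0 < p. Proof. exact: lt_trans p1. Qed.

Lemma FBL_eval_bound (y : dualSpace E) :
  exists2 c : R, 0 < c & forall f : FBL p1 E, `|val f y| <= c * `|f|.
Proof.
have [c c0 yc] := dual_bound y; exists c => // f.
have w : weak_lp_le1 p (fun _ : 'I_1 => c^-1 *: y).
  apply: weak_lp1 => // x; rewrite (_ : _ x = c^-1 * y x)//.
  by rewrite normrM gtr0_norm ?invr_gt0// ler_pdivrMl.
have := Hp_norm_ge (val f) w; rewrite -FBL_normE lee_fin.
move=> /(le_trans (lp_sum_coord p1 _ ord0)).
have /set_mem[[fh _] _] := valP f; rewrite fh ?invr_ge0 ?(ltW c0)//.
by rewrite normrM gtr0_norm ?invr_gt0// ler_pdivrMl.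
Qed.

Lemma FBL_complete (F : set_system (FBL p1 E)) :
  ProperFilter F -> cauchy F -> cvg F.
Proof.
move=> FF /cauchyP Fc.
have Fball e : 0 < e -> exists g0 : FBL p1 E, F [set g | `|g0 - g| < e].
  by move=> /Fc[g0]; rewrite -ball_normE => Fg0; exists g0.
pose l (y : dualSpace E) : R := lim ((fun g : FBL p1 E => val g y) @ F).
have Fl y : (fun g : FBL p1 E => val g y) @ F --> l y.
  have [c c0 yc] := FBL_eval_bound y.
  apply: cauchy_cvg; apply/cauchyP => e e0.
  have [g0 Fg0] := Fball _ (divr_gt0 e0 c0); exists (val g0 y).
  change (F [set g : FBL p1 E | ball (val g0 y) e (val g y)]).
  apply: filterS Fg0 => g /= gg0; rewrite -ball_normE/=.
  have := yc (g0 - g); rewrite (_ : val (g0 - g) y = val g0 y - val g y)//.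
  by move=> /le_lt_trans; apply; rewrite mulrC -ltr_pdivlMr.
have lh : pos_homog l.
  move=> a v a0.
  have fh (g : FBL p1 E) : val g (a *: v) = a * val g v.
    by have /set_mem[[gh _] _] := valP g; exact: gh.
  have := Fl (a *: v); rewrite (funext fh) => Flav.
  have Flv : (fun g : FBL p1 E => a * val g v) @ F --> a * l v.
    by apply: cvgM; [exact: cvg_cst|exact: Fl].
  exact: (cvg_unique (@norm_hausdorff _ _) Flav Flv).
have lapprox e : 0 < e -> exists g0 : FBL p1 E,
    F [set g | `|g0 - g| < e] /\ (Hp_norm p (l - val g0)%R <= e%:E)%E.
  move=> e0; have [g0 Fg0] := Fball _ e0; exists g0; split => //.
  apply: Hp_norm_le => n xs wxs; rewrite lee_fin.
  apply/ler_addgt0Pr => d d0.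
  pose C : R := lp_sum p (fun _ : 'I_n => 1).
  have C0 : 0 <= C by exact: lp_sum_ge0.
  pose eta := d / (C + 1).
  have eta0 : 0 < eta by rewrite divr_gt0// ltr_wpDl.
  have Fxs : F [set g | forall k : 'I_n, `|l (xs k) - val g (xs k)| < eta].
    by apply: filter_forall => k; move/cvgrPdist_lt : (Fl (xs k)); apply.
  have [g [/= gg0 gl]] := filter_ex (filterI Fg0 Fxs).
  rewrite (_ : (fun k => _) = fun k =>
    (val g - val g0) (xs k) + (l - val g) (xs k)); last first.
    by apply/funext => k; rewrite !fctE; lra.
  apply: (le_trans (lp_sumD p1 _ _)); apply: lerD.
    apply: le_trans (ltW gg0); rewrite distrC -lee_fin [`|g - g0|%:E]FBL_normE.
    exact: Hp_norm_ge.
  apply: (@le_trans _ _ (lp_sum p (fun _ : 'I_n => eta * 1))).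
    by apply: lp_sum_le => // k; rewrite mulr1 (gtr0_norm eta0) ltW// gl.
  rewrite lp_sumZ// gtr0_norm// /eta -/C mulrAC ler_pdivrMr ?ltr_wpDl//.
  by rewrite ler_pM2l// lerDl.
have lFBL : l \in @FBL_pred R p E.
  apply/mem_set; split; first (split; first exact: lh).
    have [g0 [_ lg0]] := lapprox 1 ltr01.
    rewrite -(subrK (val g0) l); apply: (le_lt_trans (Hp_normD p1 _ _)).
    have /set_mem[[_ g0fin] _] := valP g0.
    by apply: lte_add_pinfty; [exact: le_lt_trans lg0 (ltry _)|exact: g0fin].
  move=> e e0; have e20 : 0 < e / 2 by rewrite divr_gt0.
  have [g0 [_ lg0]] := lapprox _ e20.
  have /set_mem[_ /(_ _ e20)[g Gg gg0]] := valP g0; exists g; first exact: Gg.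
  rewrite -(subrK (val g0) l) -addrA; apply: (le_lt_trans (Hp_normD p1 _ _)).
  rewrite [e]splitr EFinD; apply: lee_ltD; [|exact: lg0|exact: gg0].
  rewrite ge0_fin_numE; last exact: Hp_norm_ge0.
  exact: le_lt_trans lg0 (ltry _).
pose lF : FBL p1 E := exist (fun h => h \in @FBL_pred R p E) l lFBL.
apply/cvg_ex; exists lF.
apply/cvgrPdist_lt => e e0; have e20 : 0 < e / 2 by rewrite divr_gt0.
have [g0 [Fg0 lg0]] := lapprox _ e20.
apply: filterS Fg0 => g /= gg0.
rewrite -(subrK g0 lF) -addrA; apply: (le_lt_trans (ler_normD _ _)).
rewrite [e]splitr; apply: ler_ltD; last exact: gg0.
have : (Hp_norm p (val (lF - g0)%R) <= (e / 2)%:E)%E by exact: lg0.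
by rewrite -(FBL_normE (lF - g0)) lee_fin.
Qed.

HB.instance Definition _ :=
  Uniform_isComplete.Build (FBL p1 E) FBL_complete.

End FBLComplete.

(* Main.v *)
Require Import Defs.
From HB Require Import structures.
From mathcomp Require Import all_boot all_order all_algebra.
From mathcomp Require Import all_classical all_reals all_analysis.
From mathcomp Require Import lra ring.

Set Implicit Arguments.
Unset Strict Implicit.
Unset Printing Implicit Defensive.

Import Order.TTheory GRing.Theory Num.Theory numFieldNormedType.Exports.

Local Open Scope classical_set_scope.
Local Open Scope ring_scope.

(** Write [|f|_p] for the norm of the free lattice and [|T|] for the operator
norm.  The sublattice generated by the evaluations [delta x] consists of the
differences [f = max_i delta a_i - max_j delta b_j] of finite maxima, so a
lattice homomorphism extending [T] can only send [f] to
[T0 f = sup_i T a_i - sup_j T b_j].  The proof shows that this is well defined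
and that [|T0 f| <= M |T| |f|_p], with [M] the p-convexity constant.  Then [T0]
extends to the closure ([extend_by_density]); the extension is unique since a
lattice homomorphism on a Banach lattice is automatically bounded
([lattice_hom_bounded]).

Inequalities between functions on the dual are transferred to [X] by a Farkas
lemma ([dual_farkas]), which is the Hahn-Banach theorem in a finite-dimensional
space: if [q] is sublinear and [d a <= q (d w_1, ..., d w_n)] for every
functional [d], then [a = sum_i b_i w_i] for some linear form [b <= q].  Taking
for [q] a maximum gives convex weights [b]; so [T0] is monotone, in particular
well defined.  Taking for [q] a maximum plus an l^p-norm shows that a pointwise
inequality [f <= (sum_k |delta w_k|^p)^(1/p)] implies
[T0 f <= (sum_k |T w_k|^p)^(1/p)] in [X]; and the norm of the right-hand side is
at most [M |T| (sum_k |w_k|^p)^(1/p)] by p-convexity.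

So the bound on [T0] follows from a theorem about [E] alone
([pietsch_domination]): if [0 <= f] and [|f|_p < N'], then there are [w_k] with
[f <= (sum_k |delta w_k|^p)^(1/p)] pointwise and
[(sum_k |w_k|^p)^(1/p) <= N'].  If there were none, Hahn-Banach would give a
positive functional [phi] on functions on the dual with
[phi (|delta x|^p) <= |x|^p] for all [x], but [phi (f^p) >= N'^p]
([pietsch_functional]).  The function [f] is linear on each of finitely many
convex cones covering the dual.  Cut the dual into disjoint cells [A_k] inside
these cones and average each cell against the density [f^(p-1)]:
[xi_k x = phi (1_(A_k) f^(p-1) delta x) / phi (1_(A_k) f^p)^(1-1/p)].
Hoelder's inequality makes [xi_1, ..., xi_n] an admissible family for [|f|_p];
positivity of [phi] keeps [xi_k] in the k-th cone, where [f] is linear, whence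
[f xi_k ^ p = phi (1_(A_k) f^p)] exactly.  Summing over [k],
[phi (f^p) <= |f|_p^p < N'^p], a contradiction ([average_over_cells]).

The expression [(sum_k |T w_k|^p)^(1/p)] is a value of the functional calculus
of [X].  A calculus exists ([calculus_exists]) because [T0] can also be built
for [R^m] in place of [E], where the generated lattice consists of piecewise
linear functions; these are dense among the continuous positively homogeneous
ones ([piecewise_linear_dense]). *)

(** * The Hahn-Banach theorem *)

Section HahnBanach.
Context (R : realType) (V : lmodType R).
Implicit Types q : V -> R.

Definition sublinear q : Prop :=
  pos_homog q /\ forall x y, q (x + y) <= q x + q y.

Lemma pos_homog0 q : pos_homog q -> q 0 = 0.
Proof. by move=> qh; rewrite -(scale0r 0) qh// mul0r. Qed.

Lemma pos_homog_le q : q 0 = 0 ->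
  (forall (a : R) x, 0 < a -> q (a *: x) <= a * q x) -> pos_homog q.
Proof.
move=> q0 qle a x; rewrite le_eqVlt => /predU1P[<-|a0].
  by rewrite scale0r mul0r.
apply/eqP; rewrite eq_le qle//=.
have : q (a^-1 *: (a *: x)) <= a^-1 * q (a *: x) by rewrite qle ?invr_gt0.
by rewrite scalerA mulVf ?gt_eqF// scale1r ler_pdivlMl.
Qed.

Lemma sublinear_geN q x : sublinear q -> - q (- x) <= q x.
Proof.
by move=> [qh qD]; have := qD x (- x); rewrite subrr pos_homog0//; lra.
Qed.

(** The infimum is finite because a sublinear [q <= q0] satisfies
[q x >= - q (- x) >= - q0 (- x)]; subadditivity survives the infimum because
two members of a chain can be replaced by the smaller one. *)
Lemma sublinear_chain_inf (A : set (V -> R)) q0 : A !=set0 ->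
  (forall q, A q -> sublinear q /\ forall x, q x <= q0 x) ->
  (forall q q', A q -> A q' ->
     (forall x, q x <= q' x) \/ (forall x, q' x <= q x)) ->
  exists q1, sublinear q1 /\ forall q, A q -> forall x, q1 x <= q x.
Proof.
move=> [qa Aqa] Asub Atot.
pose S x := [set q x | q in A].
have S_lb x : has_lbound (S x).
  exists (- q0 (- x)) => _ [q Aq <-]; have [qs qq0] := Asub _ Aq.
  by apply: le_trans (sublinear_geN x qs); rewrite lerN2.
have S_n0 x : S x !=set0 by exists (qa x), qa.
have infS q x : A q -> inf (S x) <= q x.
  by move=> Aq; apply: ge_inf => //; exists q.
exists (fun x => inf (S x)); split; last by move=> q Aq x; exact: infS.
split.
  apply: pos_homog_le => [|a x a0].
    rewrite (_ : S 0 = [set 0]) ?inf1//; apply/seteqP; split=> [_ [q Aq <-]|_ ->].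
      by have [[/pos_homog0]] := Asub _ Aq.
    by exists qa => //; have [[/pos_homog0]] := Asub _ Aqa.
  rewrite -ler_pdivrMl//; apply: lb_le_inf => // _ [q Aq <-].
  rewrite ler_pdivrMl//; have [[qh _] _] := Asub _ Aq.
  by rewrite -(qh _ _ (ltW a0)); exact: infS.
move=> x y; rewrite -lerBlDr; apply: lb_le_inf => // _ [q Aq <-].
rewrite lerBlDr -lerBlDl; apply: lb_le_inf => // _ [q' Aq' <-].
rewrite lerBlDl.
wlog qq' : q q' x y Aq Aq' / forall x, q x <= q' x.
  move=> H; have [qq'|q'q] := Atot _ _ Aq Aq'; first exact: H.
  by rewrite addrC [leRHS]addrC; exact: H.
have [[_ qD] _] := Asub _ Aq.
by apply: (le_trans (infS q _ Aq)); apply: (le_trans (qD _ _)); rewrite lerD2l.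
Qed.

Section Cone.
Context (q : V -> R) (qs : sublinear q) (K : V -> R -> Prop).
Hypotheses (K0 : K 0 0)
  (KD : forall x y r s, K x r -> K y s -> K (x + y) (r + s))
  (KZ : forall (a : R) x r, 0 < a -> K x r -> K (a *: x) (a * r))
  (Kq : forall x r, K x r -> r <= q x).

(** Lowers [q] to [q' x = inf (q (x + y) - r)], the infimum over [(y, r)] in the
cone [K].  Any linear form below [q'] then dominates [r] at [y] for every
[(y, r)] in [K]. *)
Lemma sublinear_cone : exists q', [/\ sublinear q', forall x, q' x <= q x &
  forall x r, K x r -> q' (- x) <= - r].
Proof.
have [qh qD] := qs.
pose S x := [set s | exists y r, K y r /\ s = q (x + y) - r].
have S_lb x : has_lbound (S x).
  exists (- q (- x)) => _ [y [r [Kyr ->]]].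
  have := Kq Kyr; have := qD (x + y) (- x); rewrite addrAC subrr add0r; lra.
have S_n0 x : S x !=set0 by exists (q (x + 0) - 0), 0, 0.
have infS x y r : K y r -> inf (S x) <= q (x + y) - r.
  by move=> Kyr; apply: ge_inf => //; exists y, r.
exists (fun x => inf (S x)); split; first split.
- apply: pos_homog_le => [|a x a0].
    apply/eqP; rewrite eq_le; apply/andP; split.
      by apply: le_trans (infS _ _ _ K0) _; rewrite addr0 subr0 pos_homog0.
    apply: lb_le_inf => // _ [y [r [Kyr ->]]].
    by rewrite add0r subr_ge0; exact: Kq.
  rewrite -ler_pdivrMl//; apply: lb_le_inf => // _ [y [r [Kyr ->]]].
  rewrite ler_pdivrMl// mulrBr -(qh _ _ (ltW a0)) scalerDr.
  by apply: infS; exact: KZ.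
- move=> x y; rewrite -lerBlDr; apply: lb_le_inf => // _ [u [r [Kur ->]]].
  rewrite lerBlDr -lerBlDl; apply: lb_le_inf => // _ [v [s [Kvs ->]]].
  rewrite lerBlDl; apply: (le_trans (infS _ _ _ (KD Kur Kvs))).
  by rewrite addrACA; have := qD (x + u) (y + v); lra.
- by move=> x; apply: (le_trans (infS _ _ _ K0)); rewrite addr0 subr0.
- move=> x r Kxr; apply: (le_trans (infS _ _ _ Kxr)).
  by rewrite addNr pos_homog0// sub0r.
Qed.

End Cone.

(** Minimal sublinear functionals are the linear ones; this is how linearity is
obtained in [hahn_banach_cone]. *)
Lemma sublinear_minimal q : sublinear q -> exists q',
  [/\ sublinear q', forall x, q' x <= q x &
    forall q'', sublinear q'' -> (forall x, q'' x <= q' x) -> q'' = q'].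
Proof.
move=> qs; pose P q' := sublinear q' /\ forall x, q' x <= q x.
pose below (s t : {q' | P q'}) := `[< forall x, sval t x <= sval s x >].
have [|r s t /asboolP rs /asboolP st|[s Ps] [t Pt] /asboolP st /asboolP ts||] :=
    @Zorn {q' | P q'} below.
- by move=> t; apply/asboolP.
- by apply/asboolP => x; exact: le_trans (st x) (rs x).
- have E : s = t.
    apply/funext => x; apply/eqP; rewrite eq_le.
    by apply/andP; split; [exact: ts|exact: st].
  case: t / E Pt {st ts} => Pt.
  by rewrite (Prop_irrelevance Ps Pt).
- move=> A Atot; have [[a Aa]|A0] := pselect (A !=set0); last first.
    exists (exist P q (conj qs (fun x => lexx (q x)))) => s As.
    by exfalso; apply: A0; exists s.
  have [||_ _ [s As <-] [t At <-]|q1 [q1s q1le]] :=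
      @sublinear_chain_inf [set sval t | t in A] q.
  + by exists (sval a), a.
  + by move=> _ [t At <-]; exact: (svalP t).
  + by have [/asboolP|/asboolP] := Atot _ _ As At; [right|left].
  have Pq1 : P q1.
    split=> // x; have [_ /(_ x)] := svalP a; apply: le_trans.
    by apply: q1le; exists a.
  by exists (exist P q1 Pq1) => s As; apply/asboolP => x; apply: q1le; exists s.
- move=> [q' [q's q'q]] q'min; exists q'; split=> // q'' q''s q''q'.
  have Pq'' : P q'' by split=> // x; exact: le_trans (q''q' x) (q'q x).
  have /q'min : below (exist P q' (conj q's q'q)) (exist P q'' Pq'').
    exact/asboolP.
  by case.
Qed.

(** Subspaces carrying a linear form and single points to be attained are both
cones, so this form covers extension and separation alike. *)
Theorem hahn_banach_cone q (K : V -> R -> Prop) : sublinear q -> K 0 0 ->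
  (forall x y r s, K x r -> K y s -> K (x + y) (r + s)) ->
  (forall (a : R) x r, 0 < a -> K x r -> K (a *: x) (a * r)) ->
  (forall x r, K x r -> r <= q x) ->
  exists phi : {linear V -> R}, (forall x, phi x <= q x) /\
    forall x r, K x r -> r <= phi x.
Proof.
move=> qs K0 KD KZ Kq.
have [qK [qKs qKq KqK]] := sublinear_cone qs K0 KD KZ Kq.
have [phi [phis phiqK phimin]] := sublinear_minimal qKs.
have [phih phiD] := phis.
(* Minimality of [phi] applied to its own lowering along the ray through [x]. *)
have phiN x : phi (- x) = - phi x.
  apply/eqP; rewrite eq_le; apply/andP; split; last first.
    by have := sublinear_geN (- x) phis; rewrite opprK.
  pose L y r := exists2 s : R, 0 <= s & y = s *: x /\ r = s * phi x.
  have [||||q' [q's q'phi Lq']] := @sublinear_cone phi phis L.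
  - by exists 0 => //; rewrite scale0r mul0r.
  - move=> _ _ _ _ [s s0 [-> ->]] [t t0 [-> ->]]; exists (s + t).
      exact: addr_ge0.
    by rewrite scalerDl mulrDl.
  - move=> a _ _ a0 [s s0 [-> ->]]; exists (a * s).
      by rewrite mulr_ge0// ltW.
    by rewrite scalerA mulrA.
  - by move=> _ _ [s s0 [-> ->]]; rewrite phih.
  rewrite -(phimin _ q's q'phi) [q' in leRHS](phimin _ q's q'phi).
  by apply: Lq'; exists 1; rewrite ?scale1r ?mul1r.
have phil : linear phi.
  have phiDE x y : phi (x + y) = phi x + phi y.
    apply/eqP; rewrite eq_le phiD/=.
    by have := phiD (- x) (- y); rewrite -opprD !phiN; lra.
  move=> a x y; rewrite phiDE; congr (_ + _).
  have [a0|a0] := leP 0 a; first exact: phih.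
  rewrite -[a in LHS]opprK scaleNr phiN phih ?oppr_ge0 ?ltW//.
  by rewrite mulNr opprK.
pose phiL := GRing.isLinear.Build R V R *:%R phi phil.
pose Phi : {linear V -> R} := HB.pack phi phiL.
exists Phi; split; first by move=> x; exact: le_trans (phiqK x) (qKq x).
move=> x r Kxr; have := le_trans (phiqK (- x)) (KqK _ _ Kxr).
by rewrite phiN lerN2.
Qed.

End HahnBanach.

(** * Duality *)

Section Duality.
Context (R : realType) (E : normedModType R).

Lemma dual_of_bounded (phi : {linear E -> R}) (c : R) :
  (forall x, phi x <= c * `|x|) -> exists d : dualSpace E, forall x, d x = phi x.
Proof.
move=> phic.
have phic' x : `|phi x| <= c * `|x|.
  by rewrite ler_norml phic lerNl -raddfN (le_trans (phic _))// normrN.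
have phiC : continuous phi.
  apply: (@bounded_linear_continuous R E R^o phi).
  apply/linear_boundedP; exists c; split; first exact: num_real.
  move=> M /ltW cM x; apply: (le_trans (phic' x)).
  by rewrite ler_wpM2r.
have Dphi : (phi : E -> R) \in @dual_pred R E.
  by apply/mem_set; split=> //; exact: linearP.
by exists (exist (fun f => f \in @dual_pred R E) (phi : E -> R) Dphi).
Qed.

(** Hahn-Banach along the ray through [x] yields [d] below the norm with
[d x >= |x|]. *)
Lemma dual_separates (x : E) : (forall d : dualSpace E, d x = 0) -> x = 0.
Proof.
move=> dx; apply/eqP/negP => /negP x0.
pose K y r := exists2 c : R, 0 <= c & y = c *: x /\ r = c * `|x|.
have normS : sublinear (fun y : E => `|y|).
  split; first by move=> a y a0; rewrite normrZ ger0_norm.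
  exact: ler_normD.
have [||||phi [philex phigex]] := @hahn_banach_cone R E _ K normS.
- by exists 0 => //; rewrite scale0r mul0r.
- move=> _ _ _ _ [s s0 [-> ->]] [t t0 [-> ->]]; exists (s + t).
    exact: addr_ge0.
  by rewrite scalerDl mulrDl.
- move=> a _ _ a0 [s s0 [-> ->]]; exists (a * s).
    by rewrite mulr_ge0// ltW.
  by rewrite scalerA mulrA.
- by move=> _ _ [s s0 [-> ->]]; rewrite normrZ ger0_norm.
have [|d dphi] := @dual_of_bounded phi 1.
  by move=> y; rewrite mul1r; exact: philex.
have : `|x| <= phi x.
  by apply: phigex; exists 1; rewrite ?scale1r ?mul1r.
by rewrite -dphi dx normr_le0 (negbTE x0).
Qed.

(** On the subspace of the vectors [(d (w i))_i], the form sending this vector to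
[d a] lies below [q]; any extension [b <= q] of it satisfies
[d a = d (sum_i b_i w_i)] for all [d], and
functionals separate points. *)
Theorem dual_farkas (I : finType) (w : I -> E) (q : (I -> R) -> R) (a : E) :
  sublinear q -> (forall d : dualSpace E, d a <= q (fun i => d (w i))) ->
  exists b : I -> R, (forall t, \sum_i b i * t i <= q t) /\
    a = \sum_i b i *: w i.
Proof.
move=> qs aq.
pose K (y : I -> R) r :=
  exists d : dualSpace E, y = (fun i => d (w i)) /\ r = d a.
have [||||phi [phiq Kphi]] := @hahn_banach_cone R (I -> R) q K qs.
- by exists 0; split.
- by move=> _ _ _ _ [d [-> ->]] [d' [-> ->]]; exists (d + d').
- by move=> c _ _ _ [d [-> ->]]; exists (c *: d).
- by move=> _ _ [d [-> ->]].
pose e i : I -> R := fun j => (j == i)%:R.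
have phiE t : phi t = \sum_i phi (e i) * t i.
  have {1}-> : t = \sum_i t i *: e i.
    apply/funext => j; rewrite fct_sumE (bigD1 j)//= big1 ?addr0.
      by rewrite /e fctE eqxx [_ *: _]mulr1.
    by move=> i ij; rewrite /e fctE eq_sym (negbTE ij) [_ *: _]mulr0.
  by rewrite linear_sum; apply: eq_bigr => i _; rewrite linearZ mulrC.
exists (fun i => phi (e i)); split; first by move=> t; rewrite -phiE.
apply/eqP; rewrite -subr_eq0; apply/eqP; apply: dual_separates => d.
have -> : d (a - \sum_i phi (e i) *: w i) = d a - \sum_i phi (e i) * d (w i).
  rewrite linearB linear_sum; congr (_ - _).
  by apply: eq_bigr => i _; rewrite linearZ.
apply/eqP; rewrite subr_eq0 eq_le; apply/andP; split.
  have : d a <= phi (fun i => d (w i)) by apply: Kphi; exists d.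
  by rewrite phiE.
have dN x : dual_app (- d) x = - d x by [].
have : dual_app (- d) a <= phi (fun i => dual_app (- d) (w i)).
  by apply: Kphi; exists (- d).
rewrite phiE dN -lerN2 opprK -sumrN; apply: le_trans.
by apply: ler_sum => i _; rewrite dN mulrN opprK.
Qed.

End Duality.

(** * Vector lattices *)

Local Arguments vle_add2r {R s} z [x y].
Local Arguments vle_scale {R s} [a x y].
Local Arguments vle_trans {R s} [y x z].
Local Arguments vle_norm {R s} [x y].

Section VectorLatticeTheory.
Context (R : realType) (V : vectorLatticeType R).
Implicit Types (x y z u : V) (s : seq V).

(** Equality by the universal property: the joins and sums below are compared
through the sets of their upper bounds. *)
Lemma vle_ext x y : (forall z, vle x z = vle y z) -> x = y.
Proof.
by move=> xy; apply: vle_anti; rewrite xy vle_refl -xy vle_refl.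
Qed.

Lemma vle_add2rE z x y : vle (x + z) (y + z) = vle x y.
Proof.
apply/idP/idP; last exact: vle_add2r.
by move=> /(vle_add2r (- z)); rewrite !addrK.
Qed.

Lemma vle_subl x y z : vle (x - z) y = vle x (y + z).
Proof. by rewrite -(vle_add2rE z) subrK. Qed.

Lemma vle_subr x y z : vle x (y - z) = vle (x + z) y.
Proof. by rewrite -vle_subl opprK. Qed.

Lemma vle_sub0 x y : vle (x - y) 0 = vle x y.
Proof. by rewrite vle_subl add0r. Qed.

Lemma vle_oppE x y : vle (- x) (- y) = vle y x.
Proof. by rewrite -(vle_add2rE (x + y)) addKr addrC addrK. Qed.

Lemma vle_add x y z u : vle x y -> vle z u -> vle (x + z) (y + u).
Proof.
move=> xy zu; apply: (vle_trans (vle_add2r z xy)).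
by rewrite ![y + _]addrC; exact: vle_add2r.
Qed.

Lemma vle_scaleE (a : R) x y : 0 < a -> vle (a *: x) (a *: y) = vle x y.
Proof.
move=> a0; apply/idP/idP; last by apply: vle_scale; exact: ltW.
have ai0 : 0 <= a^-1 by rewrite invr_ge0 ltW.
by move=> /(vle_scale ai0); rewrite !scalerA mulVf ?gt_eqF// !scale1r.
Qed.

Lemma vle_joinl x y : vle x (vjoin x y).
Proof. by have := vle_refl (vjoin x y); rewrite vjoin_le => /andP[]. Qed.

Lemma vle_joinr x y : vle y (vjoin x y).
Proof. by have := vle_refl (vjoin x y); rewrite vjoin_le => /andP[]. Qed.

Lemma vjoinC x y : vjoin x y = vjoin y x.
Proof. by apply: vle_ext => z; rewrite !vjoin_le andbC. Qed.

Lemma vjoinDr z x y : vjoin x y + z = vjoin (x + z) (y + z).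
Proof.
by apply: vle_ext => u; rewrite -(subrK z u) vle_add2rE !vjoin_le !vle_add2rE.
Qed.

Lemma vjoin_opp x y : - vjoin (- x) (- y) = vmeet x y.
Proof.
apply: oppr_inj; rewrite opprK; apply: vle_ext => z.
by rewrite vjoin_le -[z]opprK !vle_oppE vle_meet.
Qed.

Lemma vabs_le x z : vle (vabs x) z = vle x z && vle (- x) z.
Proof. exact: vjoin_le. Qed.

Lemma vle_abs x : vle x (vabs x). Proof. exact: vle_joinl. Qed.
Lemma vle_absN x : vle (- x) (vabs x). Proof. exact: vle_joinr. Qed.

Lemma vabs_ge0 x : vle 0 (vabs x).
Proof.
rewrite -(@vle_scaleE 2)// scaler0 -(subrr x) scaler_nat mulr2n.
by apply: vle_add; [exact: vle_abs|exact: vle_absN].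
Qed.

Lemma vabs_id x : vle 0 x -> vabs x = x.
Proof.
move=> x0; apply: vle_anti; rewrite vle_abs andbT vabs_le vle_refl/=.
by apply: (vle_trans _ x0); rewrite -(vle_add2rE x) addNr add0r.
Qed.

Lemma vabs_abs x : vabs (vabs x) = vabs x.
Proof. exact/vabs_id/vabs_ge0. Qed.

Lemma vabsN x : vabs (- x) = vabs x.
Proof. by rewrite /vabs opprK vjoinC. Qed.

Lemma vjoinB_le x y z u :
  vle (vabs (vjoin x y - vjoin z u)) (vabs (x - z) + vabs (y - u)).
Proof.
have half (a b c d : V) :
    vle (vjoin a b - vjoin c d) (vabs (a - c) + vabs (b - d)).
  rewrite vle_subl vjoin_le; apply/andP; split.
    rewrite -{1}(subrK c a) -[X in vle _ X]addrA.
    apply: vle_add; first exact: vle_abs.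
    apply: (vle_trans (vle_joinl c d)).
    by rewrite -{1}(add0r (vjoin c d)); apply: vle_add2r; exact: vabs_ge0.
  rewrite -{1}(subrK d b) -[X in vle _ X]addrA [X in vle _ X]addrCA.
  apply: vle_add; first exact: vle_abs.
  apply: (vle_trans (vle_joinr c d)).
  by rewrite -{1}(add0r (vjoin c d)); apply: vle_add2r; exact: vabs_ge0.
rewrite vabs_le half opprB/=.
by rewrite -(vabsN (x - z)) -(vabsN (y - u)) !opprB half.
Qed.

(** The value [0] on the empty sequence carries no meaning. *)
Definition vsup s : V := if s is x :: s' then foldr vjoin x s' else 0.

Lemma vsup_le s z : s != [::] -> vle (vsup s) z = all (fun x => vle x z) s.
Proof.
case: s => // x s _; rewrite /vsup; elim: s => [|y s IHs] /=.
  by rewrite andbT.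
by rewrite vjoin_le IHs /= andbCA.
Qed.

Lemma vsup_ge s x : x \in s -> vle x (vsup s).
Proof.
move=> xs; have s0 : s != [::] by case: s xs.
by have := vle_refl (vsup s); rewrite vsup_le// => /allP; apply.
Qed.

Lemma vsup_cat s s' : s != [::] -> s' != [::] ->
  vsup (s ++ s') = vjoin (vsup s) (vsup s').
Proof.
move=> s0 s'0; apply: vle_ext => z.
by rewrite vjoin_le !vsup_le// ?all_cat//; case: s s0.
Qed.

Lemma vsupD s s' : s != [::] -> s' != [::] ->
  vsup s + vsup s' = vsup [seq x + y | x <- s, y <- s'].
Proof.
move=> s0 s'0; apply: vle_ext => z; rewrite [RHS]vsup_le; last first.
  by case: s s0 => // x s _; case: s' s'0.
rewrite -vle_subr vsup_le//; apply/allP/allP => [sz v|sz x xs].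
  move=> /allpairsP[[x y] [/= xs ys ->]].
  have := sz x xs; rewrite vle_subr; apply: vle_trans.
  by rewrite addrC [x + _]addrC vle_add2rE; exact: vsup_ge.
rewrite vle_subr addrC -vle_subr vsup_le//; apply/allP => y ys.
by rewrite vle_subr addrC; apply: sz; apply: allpairs_f.
Qed.

Lemma vsupZ (a : R) s : 0 < a -> s != [::] ->
  a *: vsup s = vsup [seq a *: x | x <- s].
Proof.
move=> a0 s0; apply: vle_ext => z; rewrite [RHS]vsup_le; last by case: s s0.
rewrite all_map -{1}(scale1r z) -(mulfV (lt0r_neq0 a0)) -scalerA vle_scaleE//.
rewrite vsup_le//; apply: eq_all => x /=.
by rewrite -(vle_scaleE _ _ a0) scalerA mulfV ?gt_eqF// scale1r.
Qed.

End VectorLatticeTheory.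

(** * Lifting a linear map to the generated lattice *)

Section LinearSups.
Context (R : realType) (E : lmodType R) (V : vectorLatticeType R).
Context (S : {linear E -> V}).
Implicit Types A B : seq E.

Definition lsup A : V := vsup (map S A).

Lemma lsup_cat A B : A != [::] -> B != [::] ->
  lsup (A ++ B) = vjoin (lsup A) (lsup B).
Proof.
move=> A0 B0; rewrite /lsup map_cat vsup_cat//.
  by case: A A0.
by case: B B0.
Qed.

Lemma lsupD A B : A != [::] -> B != [::] ->
  lsup A + lsup B = lsup [seq x + y | x <- A, y <- B].
Proof.
move=> A0 B0; rewrite /lsup vsupD; last 2 first.
- by case: A A0.
- by case: B B0.
rewrite map_allpairs allpairs_mapl allpairs_mapr.
by congr vsup; apply: eq_allpairs => x y; rewrite linearD.
Qed.

Lemma lsupZ (a : R) A : 0 < a -> A != [::] ->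
  a *: lsup A = lsup [seq a *: x | x <- A].
Proof.
move=> a0 A0; rewrite /lsup vsupZ//; last by case: A A0.
by rewrite -!map_comp; congr vsup; apply: eq_map => x /=; rewrite linearZ.
Qed.

Lemma lsup_ge A x : x \in A -> vle (S x) (lsup A).
Proof. by move=> xA; apply: vsup_ge; exact: map_f. Qed.

Lemma lsup_le A z : A != [::] ->
  vle (lsup A) z = all (fun x => vle (S x) z) A.
Proof. by move=> A0; rewrite vsup_le ?all_map//; case: A A0. Qed.

End LinearSups.

Lemma allpairs_neq0 (T1 T2 T3 : eqType) (f : T1 -> T2 -> T3) s t :
  s != [::] -> t != [::] -> [seq f x y | x <- s, y <- t] != [::].
Proof. by case: s => // x s _; case: t. Qed.

Lemma cat_neq0 (T1 : eqType) (s t : seq T1) : s != [::] -> s ++ t != [::].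
Proof. by case: s. Qed.

Section FreeVectorLattice.
Context (R : realType) (E : normedModType R).

Lemma delta_linear : linear (@delta R E).
Proof. by move=> a x y; apply/funext => d; rewrite /delta linearP. Qed.

HB.instance Definition _ :=
  GRing.isLinear.Build R E (dualSpace E -> R) *:%R (@delta R E) delta_linear.

Let ev := (@delta R E : {linear E -> (dualSpace E -> R)}).

Lemma fun_vleP (T : Type) (f g : T -> R) :
  reflect (forall t, f t <= g t) (vle f g).
Proof. exact: asboolP. Qed.

Lemma lsup_delta_le A (d : dualSpace E) (M : R) :
  A != [::] -> (forall y, y \in A -> d y <= M) ->
  lsup ev A d <= M.
Proof.
case: A => // x A _; rewrite /lsup /=; elim: A => [|y A IHA] H /=.
  by apply: H; rewrite mem_head.
rewrite ge_max; apply/andP; split.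
  by apply: H; rewrite !inE eqxx orbT.
apply: IHA => z; rewrite inE => zA; apply: H.
by rewrite !inE; case/orP: zA => ->; rewrite ?orbT.
Qed.

Lemma bigmax_sublinear n : sublinear (fun t : 'I_n.+1 -> R =>
  \big[Num.max/t ord0]_i t i).
Proof.
have leM (t : 'I_n.+1 -> R) i : t i <= \big[Num.max/t ord0]_i t i.
  exact: le_bigmax.
split.
  apply: pos_homog_le => [|a t a0].
    apply/eqP; rewrite eq_le; apply/andP; split; first exact: bigmax_le.
    exact: (leM 0 ord0).
  by apply: bigmax_le => [|i _]; rewrite ler_pM2l ?leM.
by move=> s t; apply: bigmax_le => [|i _]; apply: lerD; exact: leM.
Qed.

Context (X : vectorLatticeType R) (T : {linear E -> X}).

(** The linear form given by the Farkas lemma splits into a form below the maximum,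
that is, convex weights on [D], and a form below [r]. *)
Lemma lsup_transfer (c : E) (D : seq E) m (w : 'I_m -> E)
    (r : ('I_m -> R) -> R) (u : X) :
  D != [::] -> sublinear r ->
  (forall b, (forall t, \sum_i b i * t i <= r t) ->
    vle (\sum_i b i *: T (w i)) u) ->
  (forall d : dualSpace E, d c <= lsup ev D d + r (fun k => d (w k))) ->
  vle (T c) (lsup T D + u).
Proof.
case: D => // x D _ rs ru cD.
set n := size D; pose e (i : 'I_n.+1) := (x :: D)`_i.
pose w' (i : 'I_n.+1 + 'I_m) := match i with inl j => e j | inr k => w k end.
pose q (t : 'I_n.+1 + 'I_m -> R) :=
  \big[Num.max/t (inl ord0)]_i t (inl i) + r (fun k => t (inr k)).
have [maxh maxD] := bigmax_sublinear n; have [rh rD] := rs.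
have qs : sublinear q.
  split=> [a t a0|s t]; rewrite /q.
    rewrite mulrDr; congr (_ + _).
      exact: (maxh a (fun i => t (inl i))).
    exact: (rh a (fun i => t (inr i))).
  rewrite addrACA; apply: lerD.
    exact: (maxD (fun i => s (inl i)) (fun i => t (inl i))).
  exact: (rD (fun i => s (inr i)) (fun i => t (inr i))).
have [|b [bq ->]] := @dual_farkas R E _ w' q c qs.
  move=> d; apply: (le_trans (cD d)); rewrite lerD2r.
  apply: lsup_delta_le => // y /(nthP 0)[i isz <-].
  exact: (@le_bigmax _ _ _ _ (fun j : 'I_n.+1 => d (e j)) (Ordinal isz)).
have r0 : r (fun=> 0) = 0 by exact: (pos_homog0 rh).
have max0 : \big[Num.max/0]_(i < n.+1) 0 = 0 :> R by exact: (pos_homog0 maxh).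
rewrite linear_sum big_sumType/=; apply: vle_add; last first.
  under eq_bigr do rewrite linearZ; apply: ru => t.
  have := bq (fun i => match i with inl j => 0 | inr k => t k end).
  rewrite /q big_sumType/= max0 add0r big1 ?add0r// => i _.
  by rewrite mulr0.
have bl t : \sum_i b (inl i) * t i <= \big[Num.max/t ord0]_i t i.
  have := bq (fun i => match i with inl j => t j | inr k => 0 end).
  rewrite /q big_sumType/= r0 addr0 [X in _ + X <= _]big1 ?addr0// => i _.
  by rewrite mulr0.
(* Test the form on minus a unit vector, and below on the constants 1 and -1. *)
have b0 i : 0 <= b (inl i).
  have := bl (fun j => - (j == i)%:R); rewrite (bigD1 i)//= big1.
    rewrite eqxx addr0 mulrN1 => H; rewrite -oppr_le0; apply: (le_trans H).
    by apply: bigmax_le => [|j _]; rewrite oppr_le0 ler0n.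
  by move=> j /negbTE->; rewrite oppr0 mulr0.
have b1 : \sum_i b (inl i) = 1.
  apply/eqP; rewrite eq_le; apply/andP; split.
    have := bl (fun=> 1); under eq_bigr do rewrite mulr1.
    by move=> /le_trans; apply; apply: bigmax_le.
  have := bl (fun=> -1); under eq_bigr do rewrite mulrN1.
  rewrite sumrN => H; rewrite -lerN2; apply: (le_trans H).
  by apply: bigmax_le.
rewrite -[lsup T _]scale1r -b1 scaler_suml.
elim/big_ind2: _ => [|y y' z z'|i _]; [exact: vle_refl|exact: vle_add|].
rewrite linearZ; apply: vle_scale; first exact: b0.
by apply: lsup_ge; apply: mem_nth; exact: ltn_ord.
Qed.

(** A relation rather than a function, since the representation of [f] as a
difference is far from unique. *)
Definition lift_to (f : dualSpace E -> R) (x : X) : Prop :=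
  exists A B : seq E, [/\ A != [::], B != [::],
    f = lsup ev A - lsup ev B & x = lsup T A - lsup T B].

Lemma lift_delta x : lift_to (delta x) (T x).
Proof.
by exists [:: x], [:: 0]; split; rewrite // /lsup /= !linear0 addr0.
Qed.

Lemma lift_opp f x : lift_to f x -> lift_to (- f) (- x).
Proof.
by move=> [A [B [A0 B0 -> ->]]]; exists B, A; split; rewrite // opprB.
Qed.

Lemma lift_add f x g y : lift_to f x -> lift_to g y -> lift_to (f + g) (x + y).
Proof.
move=> [A [B [A0 B0 -> ->]]] [A' [B' [A'0 B'0 -> ->]]].
exists [seq x + y | x <- A, y <- A'], [seq x + y | x <- B, y <- B'].
by split; rewrite ?allpairs_neq0// -!lsupD// opprD addrACA.
Qed.

Lemma lift_scale (a : R) f x : lift_to f x -> lift_to (a *: f) (a *: x).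
Proof.
have pos (b : R) g y : 0 < b -> lift_to g y -> lift_to (b *: g) (b *: y).
  move=> b0 [A [B [A0 B0 -> ->]]].
  exists [seq b *: x | x <- A], [seq b *: x | x <- B].
  split; rewrite -?lsupZ ?scalerBr//; [by case: A A0|by case: B B0].
move=> fx; have [a0|a0|->] := ltgtP a 0; last 2 first.
- exact: pos.
- by rewrite !scale0r; have := lift_delta 0; rewrite !linear0.
rewrite -[a]opprK !(scaleNr (- a)); apply: lift_opp; apply: pos => //.
by rewrite oppr_gt0.
Qed.

Lemma vjoin_diff (V : vectorLatticeType R) (a b c d : V) :
  vjoin (a - b) (c - d) = vjoin (a + d) (c + b) - (b + d).
Proof.
rewrite vjoinDr opprD; congr vjoin.
  by rewrite [- b - d]addrC addrA addrK.
by rewrite addrA addrK.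
Qed.

(** Differences of finite suprema are closed under joins because translations
commute with joins ([vjoin_diff]). *)
Lemma lift_join f x g y : lift_to f x -> lift_to g y ->
  lift_to (vjoin f g) (vjoin x y).
Proof.
move=> [A [B [A0 B0 -> ->]]] [C [D [C0 D0 -> ->]]].
exists ([seq x + y | x <- A, y <- D] ++ [seq x + y | x <- C, y <- B]).
exists [seq x + y | x <- B, y <- D].
split; rewrite ?cat_neq0 ?allpairs_neq0//.
  by rewrite lsup_cat ?allpairs_neq0// -!lsupD// vjoin_diff.
by rewrite lsup_cat ?allpairs_neq0// -!lsupD// vjoin_diff.
Qed.

Lemma lift_meet f x g y : lift_to f x -> lift_to g y ->
  lift_to (vmeet f g) (vmeet x y).
Proof.
move=> fx gy; rewrite -!vjoin_opp.
by apply/lift_opp/lift_join; exact: lift_opp.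
Qed.

Lemma lift_exists f : FBL_gen f -> exists x, lift_to f x.
Proof.
move=> fG; apply: (fG [set f | exists x, lift_to f x]); split; last first.
  by move=> _ [x _ <-]; exists (T x); exact: lift_delta.
split.
- by exists 0; have := lift_delta 0; rewrite !linear0.
- move=> a g h [x gx] [y hy]; exists (a *: x + y).
  by apply: lift_add => //; exact: lift_scale.
- by move=> g h [x gx] [y hy]; exists (vmeet x y); exact: lift_meet.
- by move=> g h [x gx] [y hy]; exists (vjoin x y); exact: lift_join.
Qed.

(** The crux of the transfer from the dual to [X]: the summand subtracted in [f] is
moved to the other side, after which each evaluation in the remaining maximum
can be treated on its own. *)
Lemma lift_le_sublinear f x m (w : 'I_m -> E) (r : ('I_m -> R) -> R) (u : X) :
  lift_to f x -> sublinear r ->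
  (forall b, (forall t, \sum_i b i * t i <= r t) ->
    vle (\sum_i b i *: T (w i)) u) ->
  (forall d : dualSpace E, f d <= r (fun k => d (w k))) -> vle x u.
Proof.
move=> [A [B [A0 B0 -> ->]]] rs ru fr.
rewrite vle_subl lsup_le//; apply/allP => a aA; rewrite addrC.
apply: (lsup_transfer B0 rs ru) => d; have := fr d.
rewrite (_ : _ d = lsup ev A d - lsup ev B d)// lerBlDl; apply: le_trans.
have /fun_vleP/(_ d) := @lsup_ge _ _ _ ev A a aA; exact.
Qed.

Lemma lift_le f x g y : lift_to f x -> lift_to g y ->
  (forall d, f d <= g d) -> vle x y.
Proof.
move=> fx gy fg; rewrite -vle_sub0.
have fgxy : lift_to (f - g) (x - y) by apply: lift_add => //; exact: lift_opp.
apply: (@lift_le_sublinear _ _ 0%N (fun=> 0) (fun=> 0) 0 fgxy).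
- by split=> [a v _|s t] /=; rewrite ?mulr0 ?addr0.
- by move=> b _; rewrite big_ord0; exact: vle_refl.
- by move=> d; rewrite (_ : _ d = f d - g d)// subr_le0.
Qed.

Lemma lift_uniq f x y : lift_to f x -> lift_to f y -> x = y.
Proof.
by move=> fx fy; apply: vle_anti; rewrite (lift_le fx fy)// (lift_le fy fx).
Qed.

(** The last clause is monotonicity of the lift in the strong form needed later:
[u] plays the part of [r] evaluated at the vectors [T (w i)]. *)
Theorem free_vector_lattice : exists T0 : (dualSpace E -> R) -> X,
  [/\ forall (a : R) f g, FBL_gen f -> FBL_gen g ->
        T0 (a *: f + g) = a *: T0 f + T0 g,
      forall f g, FBL_gen f -> FBL_gen g -> T0 (vjoin f g) = vjoin (T0 f) (T0 g),
      forall x, T0 (delta x) = T x &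
      forall f m (w : 'I_m -> E) (r : ('I_m -> R) -> R) (u : X),
        FBL_gen f -> sublinear r ->
        (forall b, (forall t, \sum_i b i * t i <= r t) ->
          vle (\sum_i b i *: T (w i)) u) ->
        (forall d : dualSpace E, f d <= r (fun k => d (w k))) -> vle (T0 f) u].
Proof.
pose T0 f := xget 0 [set x | lift_to f x].
have T0P f : FBL_gen f -> lift_to f (T0 f).
  by move=> /lift_exists[x fx]; exact: (@xgetPex _ 0 [set x | lift_to f x]
    (ex_intro _ x fx)).
have [G0 GD GI GU] := @FBL_gen_sublattice R E.
exists T0; split=> [a f g fG gG|f g fG gG|x|f m w r u fG].
- apply: (lift_uniq (T0P _ (GD _ _ _ fG gG))).
  by apply: lift_add; [apply: lift_scale|]; exact: T0P.
- apply: (lift_uniq (T0P _ (GU _ _ fG gG))).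
  by apply: lift_join; exact: T0P.
- apply: (lift_uniq _ (lift_delta x)); apply: T0P.
  by move=> S [_ SG]; apply: SG; exists x.
- exact: lift_le_sublinear (T0P _ fG).
Qed.

End FreeVectorLattice.

(** * Extension by density *)

Section NormedLatticeTheory.
Context (R : realType) (V : normedLatticeType R).
Implicit Types x y z u : V.

Lemma norm_vabs x : `|vabs x| = `|x|.
Proof.
by apply/eqP; rewrite eq_le !vle_norm// vabs_abs vle_refl.
Qed.

Lemma norm_le_abs x y : vle (vabs x) y -> `|x| <= `|y|.
Proof.
by move=> xy; apply: vle_norm; apply: (vle_trans xy); exact: vle_abs.
Qed.

Lemma norm_vjoinB x y z u :
  `|vjoin x y - vjoin z u| <= `|x - z| + `|y - u|.
Proof.
apply: (le_trans (norm_le_abs (vjoinB_le x y z u))).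
by apply: (le_trans (ler_normD _ _)); rewrite !norm_vabs.
Qed.

Lemma eq_norm_small (K : R) x y :
  (forall e, 0 < e -> `|x - y| <= K * e) -> x = y.
Proof.
move=> xyK; apply/eqP; rewrite -subr_eq0 -normr_le0.
apply/ler_addgt0Pr => e e0; rewrite add0r.
have K0 : 0 < `|K| + 1 by rewrite ltr_wpDl.
apply: (le_trans (xyK (e / (`|K| + 1)) (divr_gt0 e0 K0))).
rewrite mulrCA ler_piMr ?(ltW e0)// ler_pdivrMr// mul1r.
by rewrite (le_trans (ler_norm _))// lerDl.
Qed.

End NormedLatticeTheory.

(** The predicate [small e f] reads as: the size of [f] is at most [e].  Two sizes
are used: multiples of a fixed positive function for the functional calculus,
and the norm of the free lattice for the main theorem. *)
Section ExtendByDensity.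
Context (R : realType) (T : Type) (X : banachLatticeType R).
Context (G : set (T -> R)) (T0 : (T -> R) -> X).
Context (small : R -> (T -> R) -> Prop) (C : R).
Hypotheses (GS : sublattice G)
  (T0l : forall (a : R) f g, G f -> G g -> T0 (a *: f + g) = a *: T0 f + T0 g)
  (T0j : forall f g, G f -> G g -> T0 (vjoin f g) = vjoin (T0 f) (T0 g))
  (small0 : forall e, 0 < e -> small e 0)
  (smallD : forall (a : R) e e' f f' h, small e f -> small e' f' ->
    (forall t, `|h t| <= `|a| * `|f t| + `|f' t|) -> small (`|a| * e + e') h)
  (C0 : 0 <= C)
  (T0C : forall e f, G f -> small e f -> `|T0 f| <= C * e).

Definition approximable (f : T -> R) : Prop :=
  forall e, 0 < e -> exists2 g, G g & small e (f - g).

(** Determines [y] without reference to an approximating sequence, so that the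
algebraic properties of the extension follow from estimates at a single scale. *)
Definition approx_value (f : T -> R) (y : X) : Prop :=
  forall g e, G g -> small e (f - g) -> `|y - T0 g| <= C * e.

Lemma approx_dist f g g' e e' : G g -> G g' -> small e (f - g) ->
  small e' (f - g') -> `|T0 g - T0 g'| <= C * (e + e').
Proof.
move=> Gg Gg' sg sg'.
have -> : T0 g - T0 g' = T0 (-1 *: g' + g).
  by rewrite T0l// scaleN1r addrC.
have [_ GD _ _] := GS.
apply: T0C; first exact: GD.
have := @smallD 1 _ _ _ _ (-1 *: g' + g) sg sg'; rewrite normr1 mul1r; apply.
move=> t; rewrite mul1r scaleN1r addrC.
have -> : (g - g') t = (f - g') t - (f - g) t.
  by rewrite !fctE; lra.
by rewrite [leRHS]addrC; exact: ler_normB.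
Qed.

Lemma approx_value_exists f : approximable f -> exists y, approx_value f y.
Proof.
move=> fcl.
have /choice[g gP] (n : nat) : exists h, G h /\ small n.+1%:R^-1 (f - h).
  by have [|h Gh sh] := fcl n.+1%:R^-1; [rewrite invr_gt0|exists h].
pose u n := T0 (g n).
have uC m n e : G m -> small e (f - m) -> `|u n - T0 m| <= C * (n.+1%:R^-1 + e).
  by move=> Gm sm; have [Gn sn] := gP n; exact: (approx_dist Gn Gm sn sm).
have small_inv e : 0 < e -> exists N, forall n, (N <= n)%N -> C * n.+1%:R^-1 < e.
  move=> e0; have C1 : 0 < C + 1 by rewrite ltr_wpDl.
  have [N _ NP] := near_infty_natSinv_lt (PosNum (divr_gt0 e0 C1)).
  exists N => n /NP /=; rewrite ltr_pdivlMr// mulrC; apply: le_lt_trans.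
  by rewrite ler_wpM2r// lerDl.
have : cvg (u @ \oo).
  apply: cauchy_cvg; apply: cauchy_exP => e e0.
  have [N NP] := small_inv _ (divr_gt0 e0 (ltr0Sn R 1)).
  exists (u N), N => // n /= Nn; rewrite -ball_normE /=.
  have [Gn sn] := gP n; have := uC _ N _ Gn sn; rewrite mulrDr.
  by move=> /le_lt_trans; apply; rewrite [e]splitr ltrD// NP.
move=> /cvg_ex[y uy]; exists y => h e Gh sh; apply/ler_addgt0Pr => d d0.
have d20 : 0 < d / 2 by rewrite divr_gt0.
have [N NP] := small_inv _ d20.
move/cvgrPdist_lt : uy => /(_ _ d20)[M _ MP].
pose n := maxn N M.
rewrite (splitr d) -(subrK (u n) y) -addrA; apply: (le_trans (ler_normD _ _)).
have := uC _ n _ Gh sh; have := NP n (leq_maxl _ _); have := MP n (leq_maxr _ _).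
rewrite mulrDr /=.
move: (C * _) (`|y - _|) (`|u n - _|) (C * e) (d / 2) => a b c k l.
by lra.
Qed.

Let T1 f := xget 0 [set y | approx_value f y].

Let T1P f : approximable f -> approx_value f (T1 f).
Proof.
move=> /approx_value_exists[y fy].
exact: (@xgetPex _ 0 [set y | approx_value f y] (ex_intro _ y fy)).
Qed.

Let approximable_op (a : R) f f' h : approximable f -> approximable f' ->
  (forall g g', G g -> G g' -> exists2 k, G k &
    forall t, `|(h - k) t| <= `|a| * `|(f - g) t| + `|(f' - g') t|) ->
  approximable h.
Proof.
move=> fcl f'cl hk e e0; have a1 : 0 < `|a| + 1 by rewrite ltr_wpDl.
have [g Gg sg] := fcl _ (divr_gt0 e0 a1).
have [g' Gg' sg'] := f'cl _ (divr_gt0 e0 a1).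
have [k Gk kle] := hk _ _ Gg Gg'; exists k => //.
have := smallD sg sg' kle.
rewrite -[X in _ + X]mul1r -mulrDl mulrCA mulfV ?gt_eqF// mulr1.
exact.
Qed.

Theorem extend_by_density : exists T1 : (T -> R) -> X,
  [/\ forall f, G f -> T1 f = T0 f,
      forall (a : R) f g, approximable f -> approximable g ->
        T1 (a *: f + g) = a *: T1 f + T1 g,
      forall f g, approximable f -> approximable g ->
        T1 (vjoin f g) = vjoin (T1 f) (T1 g) &
      forall f e, approximable f -> small e f -> `|T1 f| <= C * e].
Proof.
have [G0 GD _ GU] := GS.
have Gcl f : G f -> approximable f.
  by move=> Gf e e0; exists f; rewrite // subrr; exact: small0.
exists T1; split.
- move=> f Gf; apply: (@eq_norm_small _ _ C) => e e0; apply: T1P => //.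
    exact: Gcl.
  by rewrite subrr; exact: small0.
- move=> a f f' fcl f'cl.
  have op_le g g' t : `|(a *: f + f' - (a *: g + g')) t| <=
      `|a| * `|(f - g) t| + `|(f' - g') t|.
    rewrite -normrM; apply: le_trans (ler_normD _ _).
    by rewrite !fctE /= opprD addrACA -mulrBr.
  have hcl : approximable (a *: f + f').
    apply: (approximable_op (a := a) fcl f'cl) => g g' Gg Gg'.
    by exists (a *: g + g') => //; exact: GD.
  apply: (@eq_norm_small _ _ (2 * (C * (`|a| + 1)))) => e e0.
  have [g Gg sg] := fcl _ e0; have [g' Gg' sg'] := f'cl _ e0.
  have := T1P hcl (GD a _ _ Gg Gg') (smallD sg sg' (op_le g g')).
  have := T1P fcl Gg sg; have := T1P f'cl Gg' sg'; rewrite T0l//.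
  have -> : T1 (a *: f + f') - (a *: T1 f + T1 f') =
      (T1 (a *: f + f') - (a *: T0 g + T0 g')) -
      (a *: (T1 f - T0 g) + (T1 f' - T0 g')).
    by rewrite scalerBr addrACA -opprD opprB addrA subrK.
  move=> f'g' fg ag; apply: (le_trans (ler_normB _ _)).
  have := ler_normD (a *: (T1 f - T0 g)) (T1 f' - T0 g').
  rewrite normrZ => ag'.
  have := ler_wpM2l (normr_ge0 a) fg.
  lra.
- move=> f f' fcl f'cl.
  have op_le g g' t : `|(vjoin f f' - vjoin g g') t| <=
      `|1| * `|(f - g) t| + `|(f' - g') t|.
    by rewrite normr1 mul1r; exact: le_norm_maxB.
  have hcl : approximable (vjoin f f').
    apply: (approximable_op (a := 1) fcl f'cl) => g g' Gg Gg'.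
    by exists (vjoin g g') => //; exact: GU.
  apply: (@eq_norm_small _ _ (4 * C)) => e e0.
  have [g Gg sg] := fcl _ e0; have [g' Gg' sg'] := f'cl _ e0.
  have := T1P hcl (GU _ _ Gg Gg') (smallD sg sg' (op_le g g')).
  have := T1P fcl Gg sg; have := T1P f'cl Gg' sg'; rewrite T0j// normr1 mul1r.
  move=> f'g' fg hg; rewrite -(subrK (vjoin (T0 g) (T0 g')) (T1 (vjoin f f'))).
  rewrite -addrA; apply: (le_trans (ler_normD _ _)).
  have := norm_vjoinB (T0 g) (T0 g') (T1 f) (T1 f').
  rewrite ![`|T0 _ - T1 _|]distrC.
  lra.
- move=> f e fcl sf; apply/ler_addgt0Pr => d d0.
  have C1 : 0 < 2 * (C + 1) by rewrite mulr_gt0// ltr_wpDl.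
  have [g Gg sg] := fcl _ (divr_gt0 d0 C1).
  have sg' : small (d / (2 * (C + 1)) + e) g.
    have := @smallD 1 _ _ _ _ g sg sf; rewrite normr1 mul1r; apply => t.
    rewrite mul1r [leRHS]addrC; have -> : g t = f t - (f - g) t.
      by rewrite !fctE; lra.
    exact: ler_normB.
  have := T1P fcl Gg sg; have := T0C Gg sg'.
  have Cd : C * (d / (2 * (C + 1))) <= d / 2.
    rewrite invfM !mulrA ler_pdivrMr ?ltr_wpDl//.
    by rewrite -mulrA mulrDr mulr1 [C * _]mulrC lerDl divr_ge0// ltW.
  rewrite mulrDr => ng nfg; rewrite -(subrK (T0 g) (T1 f)).
  apply: (le_trans (ler_normD _ _)); lra.
Qed.

End ExtendByDensity.

(** * Lattice homomorphisms on a sublattice and density of piecewise linear functions *)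

Section SublatticeTheory.
Context (R : realType) (V : vectorLatticeType R) (G : set V).
Hypothesis GS : sublattice G.

Lemma sublatticeZ (a : R) f : G f -> G (a *: f).
Proof.
by move=> Gf; have [G0 GD _ _] := GS; rewrite -[_ *: _]addr0; exact: GD.
Qed.

Lemma sublatticeD f g : G f -> G g -> G (f + g).
Proof.
by move=> Gf Gg; have [_ GD _ _] := GS; rewrite -[f]scale1r; exact: GD.
Qed.

Lemma sublatticeN f : G f -> G (- f).
Proof. by move=> Gf; rewrite -scaleN1r; exact: sublatticeZ. Qed.

Lemma sublatticeB f g : G f -> G g -> G (f - g).
Proof. by move=> Gf Gg; apply: sublatticeD => //; exact: sublatticeN. Qed.

Lemma sublattice_abs f : G f -> G (vabs f).
Proof.
by move=> Gf; have [_ _ _ GU] := GS; apply: GU => //; exact: sublatticeN.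
Qed.

Lemma sublattice_sum (I : Type) (s : seq I) (F : I -> V) :
  (forall i, G (F i)) -> G (\sum_(i <- s) F i).
Proof.
move=> GF; have [G0 _ _ _] := GS.
by elim/big_ind: _ => // f g; exact: sublatticeD.
Qed.

Context (W : vectorLatticeType R) (Phi : V -> W).
Hypotheses
  (Phil : forall (a : R) f g, G f -> G g -> Phi (a *: f + g) = a *: Phi f + Phi g)
  (Phij : forall f g, G f -> G g -> Phi (vjoin f g) = vjoin (Phi f) (Phi g)).

Lemma hom_on0 : Phi 0 = 0.
Proof.
have [G0 _ _ _] := GS; have := Phil 1 G0 G0.
by rewrite !scale1r addr0 => /esym/eqP; rewrite -subr_eq0 addrK => /eqP.
Qed.

Lemma hom_onZ (a : R) f : G f -> Phi (a *: f) = a *: Phi f.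
Proof.
by move=> Gf; have [G0 _ _ _] := GS; have := Phil a Gf G0; rewrite hom_on0 !addr0.
Qed.

Lemma hom_onD f g : G f -> G g -> Phi (f + g) = Phi f + Phi g.
Proof. by move=> Gf Gg; have := Phil 1 Gf Gg; rewrite !scale1r. Qed.

Lemma hom_onN f : G f -> Phi (- f) = - Phi f.
Proof. by move=> Gf; rewrite -scaleN1r hom_onZ// scaleN1r. Qed.

Lemma hom_on_abs f : G f -> Phi (vabs f) = vabs (Phi f).
Proof.
by move=> Gf; rewrite /vabs Phij ?hom_onN//; exact: sublatticeN.
Qed.

Lemma hom_on_meet f g : G f -> G g -> Phi (vmeet f g) = vmeet (Phi f) (Phi g).
Proof.
move=> Gf Gg; have [_ _ _ GU] := GS; rewrite -!vjoin_opp hom_onN ?Phij ?hom_onN//.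
- exact: sublatticeN.
- exact: sublatticeN.
- by apply: GU; exact: sublatticeN.
Qed.

Lemma hom_on_le f g : G f -> G g -> vle f g -> vle (Phi f) (Phi g).
Proof.
move=> Gf Gg fg; have fgE : vjoin f g = g.
  by apply: vle_anti; rewrite vjoin_le fg vle_refl vle_joinr.
by rewrite -[X in vle _ (Phi X)]fgE Phij//; exact: vle_joinl.
Qed.

Lemma hom_on_sum (I : Type) (s : seq I) (F : I -> V) : (forall i, G (F i)) ->
  Phi (\sum_(i <- s) F i) = \sum_(i <- s) Phi (F i).
Proof.
move=> GF; elim: s => [|i s IHs]; first by rewrite !big_nil hom_on0.
by rewrite !big_cons hom_onD ?IHs//; exact: sublattice_sum.
Qed.

End SublatticeTheory.

Section PiecewiseLinearDensity.
Context (R : realType) (m : nat).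
Implicit Types (h k : 'rV[R]_m -> R) (s t : 'rV[R]_m).

Lemma calc_fun_sublattice : sublattice (@calc_fun R m).
Proof.
split.
- split; first exact: cst_continuous.
  by move=> a v _; rewrite mulr0.
- move=> a f g [fc fh] [gc gh]; split.
    move=> x; apply: (@continuousD R R^o) => //; last exact: gc.
    by apply: (@continuousZl_tmp R R^o) => //; exact: fc.
  by move=> b v b0; rewrite !fctE /= fh// gh//; rewrite mulrDr [_ *: _]mulrCA.
- move=> f g [fc fh] [gc gh]; split.
    by move=> x; apply: continuous_min; [exact: fc|exact: gc].
  by move=> a v a0; rewrite /vmeet/= /fun_vmeet fh// gh// minr_pMr.
- move=> f g [fc fh] [gc gh]; split.
    by move=> x; apply: continuous_max; [exact: fc|exact: gc].
  by move=> a v a0; rewrite /vjoin/= /fun_vjoin fh// gh// maxr_pMr.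
Qed.

Definition rv_coord (i : 'I_m) t : R := t 0 i.

Lemma calc_fun_coord i : calc_fun (rv_coord i).
Proof.
split; first exact: coord_continuous.
by move=> a v _; rewrite /rv_coord mxE.
Qed.

(** The l^1-norm, written with lattice operations so that it visibly belongs to
every sublattice containing the coordinates. *)
Definition l1norm : 'rV[R]_m -> R := \sum_i vabs (rv_coord i).

Lemma vabs_funE (T : Type) (f : T -> R) x : vabs f x = `|f x|.
Proof. by rewrite -maxrN. Qed.

Lemma l1normE t : l1norm t = \sum_i `|t 0 i|.
Proof.
by rewrite /l1norm fct_sumE; apply: eq_bigr => i _; rewrite vabs_funE.
Qed.

Lemma l1norm_ge0 t : 0 <= l1norm t.
Proof. by rewrite l1normE sumr_ge0. Qed.

Lemma coord_le_l1norm t i : `|t 0 i| <= l1norm t.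
Proof. by rewrite l1normE (bigD1 i)//= lerDl sumr_ge0. Qed.

Lemma l1norm_eq0 t : l1norm t = 0 -> t = 0.
Proof.
move=> t0; apply/rowP => i; rewrite mxE; apply/eqP; rewrite -normr_le0 -t0.
exact: coord_le_l1norm.
Qed.

Lemma calc_fun_l1norm : calc_fun l1norm.
Proof.
apply: (sublattice_sum calc_fun_sublattice) => i.
exact/(sublattice_abs calc_fun_sublattice)/calc_fun_coord.
Qed.

Lemma l1sphere_compact : compact [set t | l1norm t = 1].
Proof.
apply: (@subclosed_compact _ _
    [set t : 'rV[R]_m | forall i, `[(-1), 1]%classic (t ord0 i)]).
- apply: (@closed_comp _ _ l1norm [set x | x = 1]); last exact: closed_eq.
  by move=> x _; have [c _] := calc_fun_l1norm; exact: c.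
- apply: (@rV_compact R m (fun=> `[(-1), 1]%classic)) => _.
  exact: segment_compact.
- move=> t /= t1 i; have := coord_le_l1norm t i.
  by rewrite t1 ler_norml in_itv.
Qed.

Lemma calc_fun_bounded h : calc_fun h ->
  exists B, forall t, l1norm t = 1 -> `|h t| <= B.
Proof.
move=> [hc _].
have : compact (h @` [set t | l1norm t = 1]).
  apply: continuous_compact; last exact: l1sphere_compact.
  exact: continuous_subspaceT.
move=> /(@compact_bounded R R^o)[B [_ hB]]; exists (B + 1) => t t1.
by apply: (hB (B + 1)); [rewrite ltrDl|exists t].
Qed.

(** For [s] on the l^1-sphere, the bump
[(h s + e/2) |t| + K sum_i |t_i - s_i |t| |] is above [h] on the whole sphere
if [K] is large, and close to [h] near [s].  By compactness the minimum of
finitely many bumps is close to [h] everywhere on the sphere, and homogeneity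
takes care of the other vectors. *)
Lemma piecewise_linear_dense (L : set ('rV[R]_m -> R)) h e : sublattice L ->
  L `<=` @calc_fun R m -> (forall i, L (rv_coord i)) -> calc_fun h -> 0 < e ->
  exists2 k, L k & forall t, `|h t - k t| <= e * l1norm t.
Proof.
move=> LS Lcalc Lcoord hcalc e0; have [hc hh] := hcalc.
have Ll1 : L l1norm.
  by apply: (sublattice_sum LS) => i; exact: (sublattice_abs LS).
have [B hB] := calc_fun_bounded hcalc.
pose S := [set t | l1norm t = 1].
have e20 : 0 < e / 2 by rewrite divr_gt0.
have bump s : S s -> exists k, [/\ L k, forall t, S t -> h t <= k t &
    k s < h s + e].
  move=> Ss.
  have /nbhs_ballP[d /= d0 hd] : \forall t \near s, h t < h s + e / 2.
    by apply: (@cvgr_lt _ _ _ _ _ _ (hc s)); rewrite ltrDl.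
  pose dist : 'rV[R]_m -> R := \sum_i vabs (rv_coord i - s 0 i *: l1norm).
  have distE t : S t -> dist t = \sum_i `|t 0 i - s 0 i|.
    move=> St; rewrite /dist fct_sumE; apply: eq_bigr => i _.
    by rewrite vabs_funE !fctE /= St [_ *: _]mulr1.
  (* Outside the ball of radius [d] the second term alone is at least [B - h s]. *)
  pose K := `|B - h s| / d.
  exists ((h s + e / 2) *: l1norm + K *: dist); split.
  - apply: (sublatticeD LS); apply: (sublatticeZ LS) => //.
    apply: (sublattice_sum LS) => i; apply: (sublattice_abs LS).
    by apply: (sublatticeB LS) => //; exact: (sublatticeZ LS).
  - move=> t St; rewrite [leRHS](_ : _ = (h s + e / 2) * l1norm t + K * dist t)//.
    rewrite St mulr1.
    have dist0 : 0 <= dist t by rewrite distE// sumr_ge0.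
    have K0 : 0 <= K by rewrite divr_ge0// ltW.
    have [ld|ld] := ltP (dist t) d.
      have sdt : ball s d t.
        split=> [|i j]; first exact: d0.
        rewrite (ord1 i) -ball_normE /= distrC.
        apply: le_lt_trans ld; rewrite distE// (bigD1 j)//= lerDl.
        by rewrite sumr_ge0.
      have /ltW hts : h t < h s + e / 2 := hd t sdt.
      by apply: (le_trans hts); rewrite lerDl mulr_ge0.
    have : B - h s <= K * dist t.
      apply: (le_trans (ler_norm _)); rewrite /K mulrAC ler_pdivlMr//.
      by rewrite ler_wpM2l.
    have := hB t St; rewrite ler_norml => /andP[_]; lra.
  - rewrite [ltLHS](_ : _ = (h s + e / 2) * l1norm s + K * dist s)//.
    rewrite Ss distE// big1 => [|i _]; last by rewrite subrr normr0.
    by rewrite mulr0 addr0 mulr1 ltrD2l ltr_pdivrMr// ltr_pMr// ltr1n.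
pose kk s := xget 0 [set k | [/\ L k, forall t, S t -> h t <= k t &
    k s < h s + e]].
have kkP s : S s -> [/\ L (kk s), forall t, S t -> h t <= kk s t &
    kk s s < h s + e].
  by move=> /bump[k kP]; exact: (@xgetPex _ 0 [set k | [/\ L k, _ & _]]
    (ex_intro _ k kP)).
have := l1sphere_compact; rewrite compact_cover.
move=> /(_ _ S (fun s => [set t | kk s t - h t < e])).
case=> [s /kkP[/Lcalc[kc _] _ _]|s Ss|D DS Dcov].
- apply: (@open_comp _ _ (fun t => kk s t - h t) [set x | x < e]).
    by move=> x _; apply: (@continuousB R R^o); [exact: kc|exact: hc].
  exact: open_lt.
- by exists s => //=; have [_ _] := kkP s Ss; rewrite ltrBlDl.
have [k [Lk hk kle]] : exists k, [/\ L k, forall t, S t -> h t <= k t &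
    forall s t, s \in finmap.enum_fset D -> k t <= kk s t].
  have : {in finmap.enum_fset D, forall s, S s}.
    by move=> s /DS/set_mem.
  move: (finmap.enum_fset D); elim=> [_|s r IHr rS].
    (* Starting the minimum from an upper bound of [h] covers the empty cover. *)
    exists (B *: l1norm); split => //; first exact: (sublatticeZ LS).
    move=> t St; rewrite [leRHS](_ : _ = B * l1norm t)// St mulr1.
    exact: le_trans (ler_norm _) (hB t St).
  have [|k [Lk hk kle]] := IHr.
    by move=> u ur; apply: rS; rewrite inE ur orbT.
  have [Ls hs _] := kkP s (rS s (mem_head _ _)).
  have [_ _ LI _] := LS.
  exists (vmeet (kk s) k); split; first exact: LI.
    move=> t St; rewrite [leRHS](_ : _ = Num.min (kk s t) (k t))//.
    by rewrite le_min hs// hk.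
  move=> u t; rewrite inE => /predU1P[->|ur].
    by rewrite [leLHS](_ : _ = Num.min (kk s t) (k t))// ge_min lexx.
  by rewrite [leLHS](_ : _ = Num.min (kk s t) (k t))// ge_min kle// orbT.
exists k => // t.
have [t0|t0] := eqVneq (l1norm t) 0.
  have [_ kh] := Lcalc _ Lk.
  rewrite (l1norm_eq0 t0) (pos_homog0 hh) (pos_homog0 kh) subrr normr0.
  by rewrite mulr_ge0 ?l1norm_ge0 ?ltW.
have lt0 : 0 < l1norm t by rewrite lt_def t0 l1norm_ge0.
pose t1 := (l1norm t)^-1 *: t.
have St1 : S t1.
  have [_ lh] := calc_fun_l1norm.
  by rewrite /S /= /t1 lh ?invr_ge0 ?ltW// mulVf.
have -> : t = l1norm t *: t1 by rewrite /t1 scalerA mulfV// scale1r.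
have [_ kh] := Lcalc _ Lk.
have [_ lh] := calc_fun_l1norm.
rewrite (hh _ _ (ltW lt0)) (kh _ _ (ltW lt0)) (lh _ _ (ltW lt0)) -mulrBr.
rewrite normrM ger0_norm ?(ltW lt0)//.
rewrite St1 mulr1 mulrC ler_wpM2r ?(ltW lt0)// distrC ger0_norm ?subr_ge0 ?hk//.
have [s sD /=] := Dcov t1 St1; move/ltW; apply: le_trans.
by rewrite lerD2r kle.
Qed.

End PiecewiseLinearDensity.

(** * Existence of the functional calculus *)

Section Krivine.
Context (R : realType) (X : banachLatticeType R) (m : nat) (x : 'I_m -> X).

Definition dual_coords (d : dualSpace 'rV[R]_m) : 'rV[R]_m :=
  \row_i d (delta_mx 0 i).

Lemma FBL_gen_delta (E : normedModType R) (y : E) : FBL_gen (delta y).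
Proof. by move=> S [_ SG]; apply: SG; exists y. Qed.

(** The dual of [R^m] is [R^m], so the generated lattice over it is the lattice of
piecewise linear functions of [m] variables, and the lift is the calculus on it. *)
Theorem calculus_exists : exists Phi, is_calculus x Phi.
Proof.
have lcl : linear (fun a : 'rV[R]_m => \sum_i a 0 i *: x i).
  move=> a u v; rewrite scaler_sumr -big_split; apply: eq_bigr => i _ /=.
  by rewrite !mxE scalerDl scalerA.
pose lcL := GRing.isLinear.Build R 'rV[R]_m X *:%R _ lcl.
pose lc : {linear 'rV[R]_m -> X} :=
  HB.pack (fun a : 'rV[R]_m => \sum_i a 0 i *: x i) lcL.
have [T0 [T0l T0j T0d _]] := @free_vector_lattice R _ X lc.
have GS := @FBL_gen_sublattice R 'rV[R]_m.
pose pull (h : 'rV[R]_m -> R) := h \o dual_coords.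
pose L := [set h | calc_fun h /\ FBL_gen (pull h)].
have LS : sublattice L.
  have [C0 CD CI CU] := @calc_fun_sublattice R m; have [G0 GD GI GU] := GS.
  split.
  - by split.
  - by move=> a f g [fc fG] [gc gG]; split; [exact: CD|exact: (GD a _ _ fG gG)].
  - by move=> f g [fc fG] [gc gG]; split; [exact: CI|exact: (GI _ _ fG gG)].
  - by move=> f g [fc fG] [gc gG]; split; [exact: CU|exact: (GU _ _ fG gG)].
have pull_coord i : pull (rv_coord i) = delta (delta_mx 0 i).
  by apply/funext => d; rewrite /pull /= /rv_coord mxE.
have Lcoord i : L (rv_coord i).
  split; first exact: calc_fun_coord.
  by rewrite pull_coord; exact: FBL_gen_delta.
pose v := pull (@l1norm R m).
have Gv : FBL_gen v.
  suff [] : L (@l1norm R m) by [].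
  by apply: (sublattice_sum LS) => i; exact: (sublattice_abs LS).
have v0 d : 0 <= v d by exact: l1norm_ge0.
pose small e (f : dualSpace 'rV[R]_m -> R) :=
  0 <= e /\ forall d, `|f d| <= e * v d.
have small0 e : 0 < e -> small e 0.
  by move=> e0; split=> [|d]; rewrite ?normr0 ?mulr_ge0// ltW.
have smallD (a : R) e e' f f' h : small e f -> small e' f' ->
    (forall d, `|h d| <= `|a| * `|f d| + `|f' d|) -> small (`|a| * e + e') h.
  move=> [e0 fe] [e'0 f'e'] hff'; split; first by rewrite addr_ge0 ?mulr_ge0.
  move=> d; apply: (le_trans (hff' d)); rewrite mulrDl lerD// -mulrA.
  by rewrite ler_wpM2l.
have T0C e f : FBL_gen f -> small e f -> `|T0 f| <= `|T0 v| * e.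
  move=> Gf [e0 fe].
  have Gev : FBL_gen (e *: v) by exact: (sublatticeZ GS).
  have fev : vle (vabs f) (e *: v).
    by apply/fun_vleP => d; rewrite vabs_funE; exact: fe.
  have := hom_on_le T0j (sublattice_abs GS Gf) Gev fev.
  rewrite (hom_on_abs GS T0l T0j)// (hom_onZ GS T0l)// => /norm_le_abs.
  by rewrite normrZ ger0_norm// mulrC.
have [T1 [T1T0 T1l T1j _]] :=
  extend_by_density GS T0l T0j small0 smallD (normr_ge0 _) T0C.
have pull_approx h : calc_fun h -> approximable (@FBL_gen R _) small (pull h).
  move=> hc e e0.
  have [k [kc kG] hk] :=
    piecewise_linear_dense LS (fun _ => @proj1 _ _) Lcoord hc e0.
  exists (pull k); first exact: kG.
  by split=> [|d]; [exact: ltW|exact: hk].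
have Phil (a : R) g h : calc_fun g -> calc_fun h ->
    T1 (pull (a *: g + h)) = a *: T1 (pull g) + T1 (pull h).
  by move=> gc hc; rewrite -T1l//; exact: pull_approx.
have Phij g h : calc_fun g -> calc_fun h ->
    T1 (pull (vjoin g h)) = vjoin (T1 (pull g)) (T1 (pull h)).
  by move=> gc hc; rewrite -T1j//; exact: pull_approx.
exists (T1 \o pull); split => //.
- exact: (hom_on_meet (@calc_fun_sublattice R m) Phil Phij).
- move=> i; rewrite /= (_ : pull _ = delta (delta_mx 0 i)) ?pull_coord//.
  rewrite T1T0; last exact: FBL_gen_delta.
  rewrite T0d /= (bigD1 i)//= mxE !eqxx scale1r big1 ?addr0// => j ji.
  by rewrite mxE (negbTE ji) scale0r.
Qed.

Lemma calculusP : is_calculus x (calculus x).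
Proof.
have [Phi PhiP] := calculus_exists.
exact: (@xgetPex _ (fun=> 0) [set Psi | is_calculus x Psi]
  (ex_intro _ Phi PhiP)).
Qed.

(** Turns a linear form below the l^p-sum, as produced by the Farkas lemma, into a
bound by the l^p-sum of the calculus. *)
Lemma calculus_linear_le (b : 'I_m -> R) q : calc_fun q ->
  (forall t : 'rV[R]_m, \sum_i b i * t 0 i <= q t) ->
  vle (\sum_i b i *: x i) (calculus x q).
Proof.
move=> qc bq; have [Phil _ Phij Phix] := calculusP.
have CS := @calc_fun_sublattice R m.
pose l := \sum_i b i *: @rv_coord R m i.
have Cb i : calc_fun (b i *: @rv_coord R m i).
  by apply: (sublatticeZ CS); exact: calc_fun_coord.
have Cl : calc_fun l by exact: (sublattice_sum CS).
have <- : calculus x l = \sum_i b i *: x i.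
  rewrite (hom_on_sum CS Phil _ Cb); apply: eq_bigr => i _.
  by rewrite (hom_onZ CS Phil (b i) (calc_fun_coord R i)) -Phix.
apply: (hom_on_le Phij Cl qc); apply/fun_vleP => t.
by rewrite /l fct_sumE; exact: bq.
Qed.

End Krivine.

(** * Positive functionals on p-dominated functions *)

Section PietschFunctional.
Context (R : realType) (p : R) (p1 : 1 < p) (E : normedModType R).
Implicit Types (w : seq E) (d : dualSpace E) (f g h : dualSpace E -> R).

Let p0 : 0 < p. Proof. exact: lt_trans p1. Qed.
Let pN0 : p != 0. Proof. by rewrite gt_eqF. Qed.

Definition psum w d : R := \sum_(x <- w) `|d x| `^ p.
Definition pweight w : R := \sum_(x <- w) `|x| `^ p.

Lemma psum_ge0 w d : 0 <= psum w d.
Proof. by apply: sumr_ge0 => x _; exact: powR_ge0. Qed.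

Lemma pweight_ge0 w : 0 <= pweight w.
Proof. by apply: sumr_ge0 => x _; exact: powR_ge0. Qed.

Lemma psum_cat w w' d : psum (w ++ w') d = psum w d + psum w' d.
Proof. exact: big_cat. Qed.

Lemma pweight_cat w w' : pweight (w ++ w') = pweight w + pweight w'.
Proof. exact: big_cat. Qed.

Definition pscale (a : R) w := [seq a `^ p^-1 *: x | x <- w].

Lemma psum_scale (a : R) w d : 0 <= a -> psum (pscale a w) d = a * psum w d.
Proof.
move=> a0; rewrite /psum big_map mulr_sumr; apply: eq_bigr => x _.
rewrite linearZ normrM powRM// ger0_norm ?powR_ge0//.
by rewrite -powRrM mulVf// powRr1.
Qed.

Lemma pweight_scale (a : R) w : 0 <= a -> pweight (pscale a w) = a * pweight w.
Proof.
move=> a0; rewrite /pweight big_map mulr_sumr; apply: eq_bigr => x _.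
rewrite normrZ powRM// ger0_norm ?powR_ge0//.
by rewrite -powRrM mulVf// powRr1.
Qed.

Definition dominated : set (dualSpace E -> R) :=
  [set h | exists w, forall d, `|h d| <= psum w d].

Lemma dominated_le h g : dominated g -> (forall d, `|h d| <= `|g d|) ->
  dominated h.
Proof. by move=> [w gw] hg; exists w => d; exact: le_trans (hg d) (gw d). Qed.

Lemma dominatedD h g : dominated h -> dominated g -> dominated (h + g).
Proof.
move=> [w hw] [w' gw']; exists (w ++ w') => d; rewrite psum_cat.
by apply: (le_trans (ler_normD _ _)); exact: lerD.
Qed.

Lemma dominatedZ (a : R) h : dominated h -> dominated (a *: h).
Proof.
move=> [w hw]; exists (pscale `|a| w) => d; rewrite psum_scale//.
by rewrite normrM ler_wpM2l.
Qed.

Lemma dominated0 : dominated 0.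
Proof. by exists [::] => d; rewrite normr0 psum_ge0. Qed.

Lemma dominated_delta x : dominated (fun d => `|d x| `^ p).
Proof.
by exists [:: x] => d; rewrite /psum big_seq1 ger0_norm// powR_ge0.
Qed.

(** A type of its own is needed because the gauge below is finite only on dominated
functions, while the Hahn-Banach theorem asks for a functional on a whole space. *)
Definition dominated_pred : {pred dualSpace E -> R} := mem dominated.

Definition domSpace : Type := {h : dualSpace E -> R | h \in dominated_pred}.

HB.instance Definition _ := SubType.on domSpace.
HB.instance Definition _ := Choice.on domSpace.

Lemma dominated_submod : subsemimod_closed dominated_pred.
Proof.
split; first split.
- exact/mem_set/dominated0.
- by move=> f g /set_mem Ff /set_mem Fg; exact/mem_set/dominatedD.
- by move=> a f /set_mem Ff; exact/mem_set/dominatedZ.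
Qed.

HB.instance Definition _ := GRing.SubChoice_isSubLmodule.Build R
  (dualSpace E -> R) dominated_pred domSpace dominated_submod.

(** One-sided in [h], so that a linear form below it is positive. *)
Definition dom_gauge (h : domSpace) : R :=
  inf [set pweight w | w in [set w | forall d, val h d <= psum w d]].

Lemma dom_gauge_lb (h : domSpace) : has_lbound
  [set pweight w | w in [set w | forall d, val h d <= psum w d]].
Proof. by exists 0 => _ [w _ <-]; exact: pweight_ge0. Qed.

Lemma dom_gauge_le (h : domSpace) w :
  (forall d, val h d <= psum w d) -> dom_gauge h <= pweight w.
Proof. by move=> hw; apply: ge_inf; [exact: dom_gauge_lb|exists w]. Qed.

Lemma dom_gauge_ge (h : domSpace) c :
  (forall w, (forall d, val h d <= psum w d) -> c <= pweight w) ->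
  c <= dom_gauge h.
Proof.
move=> cw; apply: lb_le_inf; last by move=> _ [w hw <-]; exact: cw.
have /set_mem[w hw] := valP h; exists (pweight w), w => // d.
exact: le_trans (ler_norm _) (hw d).
Qed.

Lemma dom_gauge_sublinear : sublinear dom_gauge.
Proof.
split.
  apply: pos_homog_le => [|a h a0].
    apply/eqP; rewrite eq_le dom_gauge_ge ?andbT//.
      have := @dom_gauge_le 0 [::]; rewrite /pweight big_nil; apply => d.
      by rewrite /psum big_nil.
    by move=> w _; exact: pweight_ge0.
  rewrite -ler_pdivrMl//; apply: dom_gauge_ge => w hw.
  rewrite ler_pdivrMl// -(pweight_scale _ (ltW a0)); apply: dom_gauge_le => d.
  rewrite (psum_scale _ _ (ltW a0)) (_ : val (a *: h) d = a * val h d)//.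
  by rewrite ler_pM2l.
move=> h g; rewrite -lerBlDr; apply: dom_gauge_ge => w hw.
rewrite lerBlDr -lerBlDl; apply: dom_gauge_ge => w' gw'.
rewrite lerBlDl -pweight_cat; apply: dom_gauge_le => d.
by rewrite psum_cat (_ : val (h + g) d = val h d + val g d)// lerD.
Qed.

(** The gauge is at least [c] at [g] by hypothesis; Hahn-Banach along the ray
through [g] keeps this value.  Bounds on [phi] come from explicit dominations: the
empty one for negative functions, the one by [x] itself for [|delta x|^p]. *)
Theorem pietsch_functional g (c : R) : dominated g ->
  (forall w, (forall d, g d <= psum w d) -> c <= pweight w) ->
  exists phi : (dualSpace E -> R) -> R,
    [/\ forall (a : R) f h, dominated f -> dominated h ->
          phi (a *: f + h) = a * phi f + phi h,
        forall h, dominated h -> (forall d, 0 <= h d) -> 0 <= phi h,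
        forall x, phi (fun d => `|d x| `^ p) <= `|x| `^ p &
        c <= phi g].
Proof.
move=> gdom gc.
pose toS h : domSpace := insubd 0 h.
have toSK h : dominated h -> val (toS h) = h.
  by move=> hdom; rewrite /toS insubdK//; exact/mem_set.
pose K (y : domSpace) r := exists2 a : R, 0 <= a & y = a *: toS g /\ r = a * c.
have [||||phi [phile Kphi]] := hahn_banach_cone (K := K) dom_gauge_sublinear.
- by exists 0 => //; rewrite scale0r mul0r.
- move=> _ _ _ _ [s s0 [-> ->]] [t t0 [-> ->]]; exists (s + t).
    exact: addr_ge0.
  by rewrite scalerDl mulrDl.
- move=> a _ _ a0 [s s0 [-> ->]]; exists (a * s).
    by rewrite mulr_ge0// ltW.
  by rewrite scalerA mulrA.
- move=> _ _ [a a0 [-> ->]]; have [gh _] := dom_gauge_sublinear.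
  rewrite gh// ler_wpM2l//; apply: dom_gauge_ge => w; rewrite toSK//.
  exact: gc.
exists (fun h => phi (toS h)); split.
- move=> a f h fdom hdom.
  have -> : toS (a *: f + h) = a *: toS f + toS h; last by rewrite linearP.
  apply: val_inj; rewrite toSK; last first.
    by apply: dominatedD => //; exact: dominatedZ.
  rewrite (_ : val (a *: toS f + toS h) = a *: val (toS f) + val (toS h))//.
  by rewrite !toSK.
- move=> h hdom h0; rewrite -lerN2 oppr0 -linearN; apply: (le_trans (phile _)).
  rewrite (_ : 0 = pweight [::]); last by rewrite /pweight big_nil.
  apply: dom_gauge_le => d; rewrite (_ : val _ d = - val (toS h) d)// toSK//.
  by rewrite /psum big_nil oppr_le0.
- move=> x; apply: (le_trans (phile _)).
  rewrite (_ : `|x| `^ p = pweight [:: x]); last by rewrite /pweight big_seq1.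
  apply: dom_gauge_le => d; rewrite toSK; last exact: dominated_delta.
  by rewrite /psum big_seq1.
- by apply: Kphi; exists 1; rewrite ?scale1r ?mul1r.
Qed.

End PietschFunctional.

(** * Averaging over conical cells *)

Section Averaging.
Context (R : realType) (p : R) (p1 : 1 < p) (E : normedModType R).
Implicit Types (d : dualSpace E) (f g h : dualSpace E -> R).
Context (phi : (dualSpace E -> R) -> R).
Local Notation dom := (@dominated R p E).
Hypotheses
  (phil : forall (a : R) f h, dom f -> dom h ->
    phi (a *: f + h) = a * phi f + phi h)
  (phi_ge0 : forall h, dom h -> (forall d, 0 <= h d) -> 0 <= phi h)
  (phi_delta : forall x, phi (fun d => `|d x| `^ p) <= `|x| `^ p).

Let p0 : 0 < p. Proof. exact: lt_trans p1. Qed.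
Let pN0 : p != 0. Proof. by rewrite gt_eqF. Qed.

Let phi0 : phi 0 = 0.
Proof.
have := phil 1 (@dominated0 R p E) (@dominated0 R p E).
by rewrite scaler0 addr0 mul1r; lra.
Qed.

Let phiD f h : dom f -> dom h -> phi (f + h) = phi f + phi h.
Proof. by move=> fd hd; have := phil 1 fd hd; rewrite scale1r mul1r. Qed.

Let phiZ (a : R) f : dom f -> phi (a *: f) = a * phi f.
Proof.
by move=> fd; have := phil a fd (@dominated0 R p E); rewrite addr0 phi0 addr0.
Qed.

Let phi_le f h : dom f -> dom h -> (forall d, f d <= h d) -> phi f <= phi h.
Proof.
move=> fd hd fh; rewrite -subr_ge0.
have -> : phi h - phi f = phi (-1 *: f + h) by rewrite phil// mulN1r addrC.
apply: phi_ge0; first by apply: dominatedD => //; exact: dominatedZ.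
by move=> d; rewrite scaleN1r [leRHS](_ : _ = - f d + h d)// addrC subr_ge0.
Qed.

Let phi_sum (I : Type) (s : seq I) (F : I -> dualSpace E -> R) :
  (forall i, dom (F i)) -> phi (\sum_(i <- s) F i) = \sum_(i <- s) phi (F i).
Proof.
move=> Fd; elim: s => [|i s IHs]; first by rewrite !big_nil.
rewrite !big_cons phiD ?IHs//.
by elim/big_ind: _ => //; [exact: dominated0|exact: dominatedD].
Qed.

(** The tangent inequality for [t ^ p], which is Young's inequality in the form
suited to functionals: it is linear in [b ^ p] and [a ^ p]. *)
Lemma young_powR (a b : R) : 0 <= a -> 0 <= b ->
  p * (a `^ (p - 1) * b) <= b `^ p + (p - 1) * a `^ p.
Proof.
move=> a0 b0; have q0 : 0 < p - 1 by rewrite subr_gt0.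
have qN0 : p - 1 != 0 by rewrite gt_eqF.
have pq : p^-1 + (p / (p - 1))^-1 = 1.
  by rewrite invf_div -{1}(mul1r p^-1) -mulrDl addrC subrK mulfV.
have := conjugate_powR b0 (powR_ge0 a (p - 1)) p0 (divr_gt0 p0 q0) pq.
rewrite -powRrM [(p - 1) * _]mulrCA mulfV// mulr1 => H.
have := ler_wpM2l (ltW p0) H; rewrite [b * _]mulrC => /le_trans; apply.
by rewrite le_eqVlt; apply/predU1P; left; field; rewrite qN0 pN0.
Qed.

Context (f : dualSpace E -> R) (f0 : forall d, 0 <= f d).
Context (n : nat) (S : 'I_n -> set E) (w : 'I_n -> E).
Hypotheses
  (cover : forall d, exists k, forall y, S k y -> 0 <= d y)
  (fw : forall k d, (forall y, S k y -> 0 <= d y) -> f d = d (w k)).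

Lemma linear_on_cells_dominated : dom (fun d => f d `^ p).
Proof.
exists [seq w k | k <- enum 'I_n] => d; have [k /fw fk] := cover d.
rewrite ger0_norm ?powR_ge0// /psum big_map big_enum (bigD1 k)//=.
rewrite -fk ger0_norm// lerDl; apply: sumr_ge0 => i _; exact: powR_ge0.
Qed.

(** Each member of the family averages a cell with density [f ^ (p - 1)].  The cells are
made disjoint by choosing for each functional one cone containing it: any choice
will do, as [phi] acts on arbitrary dominated functions. *)
Theorem average_over_cells : exists xs : 'I_n -> dualSpace E,
  weak_lp_le1 p xs /\ \sum_k `|f (xs k)| `^ p = phi (fun d => f d `^ p).
Proof.
have q0 : 0 < p - 1 by rewrite subr_gt0.
have /choice[cell cellP] := cover.
pose A k d : R := (cell d == k)%:R.
have A01 k d : 0 <= A k d <= 1 by rewrite ler0n lern1 leq_b1.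
have AE k d : A k d != 0 -> cell d = k.
  by rewrite /A; case: (cell d =P k) => //= _; rewrite mulr0n eqxx.
pose F k d := A k d * f d `^ p.
pose Y k u d := A k d * (f d `^ (p - 1) * d u).
pose B k u d := A k d * `|d u| `^ p.
have A_dom k h : dom h -> dom (fun d => A k d * h d).
  move=> hd; apply: (dominated_le hd) => d; have /andP[A0 A1] := A01 k d.
  by rewrite normrM ger0_norm// ler_piMl.
have F_dom k : dom (F k) by apply: A_dom; exact: linear_on_cells_dominated.
have B_dom k u : dom (B k u) by apply: A_dom; exact: dominated_delta.
have Y0_dom u : dom (fun d => f d `^ (p - 1) * d u).
  apply: (@dominated_le _ _ _ _ (p^-1 *: ((fun d => `|d u| `^ p) +
      (p - 1) *: (fun d => f d `^ p)))).
    apply: (dominatedZ p1); apply: dominatedD; first exact: dominated_delta.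
    by apply: (dominatedZ p1); exact: linear_on_cells_dominated.
  move=> d; rewrite [leRHS](_ : _ = `|p^-1 *
    (`|d u| `^ p + (p - 1) * f d `^ p)|)//.
  have rhs0 : 0 <= `|d u| `^ p + (p - 1) * f d `^ p.
    by rewrite addr_ge0 ?powR_ge0// mulr_ge0 ?powR_ge0// ltW.
  rewrite normrM (ger0_norm (powR_ge0 _ _)) [leRHS]ger0_norm; last first.
    by rewrite mulr_ge0// invr_ge0 ltW.
  by rewrite ler_pdivlMl//; apply: young_powR.
have Y_dom k u : dom (Y k u) by exact: A_dom.
pose alpha k := phi (F k).
have alpha0 k : 0 <= alpha k.
  apply: phi_ge0 => // d; have /andP[A0 _] := A01 k d.
  by rewrite mulr_ge0// powR_ge0.
(* The normalisation; it vanishes when [alpha k = 0], as [0] to a nonzero power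
   is [0]. *)
pose c k := alpha k `^ (- (p - 1) / p).
have cK k : 0 < alpha k -> (c k * alpha k) `^ p = alpha k.
  move=> ak; rewrite powRM ?powR_ge0// /c -powRrM divfK//.
  rewrite -powRD ?gt_eqF ?implybT// (_ : _ + _ = 1) ?powRr1//; ring.
pose xi k u := c k * phi (Y k u).
have xi_lin k : linear (xi k).
  move=> a u v.
  rewrite [RHS](_ : _ = a * (c k * phi (Y k u)) + c k * phi (Y k v))//.
  rewrite mulrCA -mulrDr -phil//; congr (_ * phi _); apply/funext => d.
  rewrite [RHS](_ : _ = a * Y k u d + Y k v d)// /Y.
  have -> : d (a *: u + v) = a * d u + d v by rewrite linearP.
  ring.
(* Hoelder for [phi], by optimising the scale [s] in Young's inequality; the
   optimum is [s = phi absY / alpha k]. *)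
have holder k u : `|xi k u| `^ p <= phi (B k u).
  have B0 : 0 <= phi (B k u).
    apply: phi_ge0 => // d; have /andP[A0 _] := A01 k d.
    by rewrite mulr_ge0// powR_ge0.
  have [ak0|akN0] := eqVneq (alpha k) 0.
    rewrite /xi /c ak0 powR0 ?mul0r ?normr0 ?powR0//.
    by rewrite mulf_eq0 oppr_eq0 invr_eq0 (negbTE pN0) orbF gt_eqF.
  have ak : 0 < alpha k by rewrite lt_def akN0 alpha0.
  pose absY d := A k d * (f d `^ (p - 1) * `|d u|).
  have absY_dom : dom absY.
    apply: (dominated_le (Y_dom k u)) => d.
    by rewrite /absY /Y !normrM normr_id.
  have Yle : `|phi (Y k u)| <= phi absY.
    rewrite ler_norml; apply/andP; split.
      rewrite -mulN1r -phiZ//; apply: phi_le => //; first exact: (dominatedZ p1).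
      move=> d; rewrite [leLHS](_ : _ = -1 * absY d)// mulN1r lerNl /absY /Y.
      have /andP[A0 _] := A01 k d; rewrite -!mulrN.
      by rewrite ler_wpM2l// ler_wpM2l ?powR_ge0// -normrN ler_norm.
    apply: phi_le => // d; have /andP[A0 _] := A01 k d.
    by rewrite ler_wpM2l// ler_wpM2l ?powR_ge0// ler_norm.
  have g0 : 0 <= phi absY by exact: le_trans Yle.
  set g := phi absY in Yle g0.
  have [s s0 sg] : exists2 s, 0 <= s & s * alpha k = g.
    by exists (g / alpha k); [rewrite divr_ge0|rewrite divfK].
  have main : s `^ p * alpha k <= phi (B k u).
    have : phi ((p * s `^ (p - 1)) *: absY) <=
        phi (((p - 1) * s `^ p) *: F k + B k u).
      apply: phi_le.
      - exact: (dominatedZ p1).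
      - by apply: dominatedD => //; exact: (dominatedZ p1).
      move=> d; rewrite [leLHS](_ : _ = p * s `^ (p - 1) * absY d)//.
      rewrite [leRHS](_ : _ = (p - 1) * s `^ p * F k d + B k u d)//.
      rewrite /absY /F /B; have /andP[A0 _] := A01 k d.
      have := young_powR (mulr_ge0 s0 (f0 d)) (normr_ge0 (d u)).
      rewrite !powRM// => /(ler_wpM2l A0) H.
      apply: (le_trans _ (le_trans H _)); rewrite le_eqVlt; apply/predU1P;
        left; ring.
    rewrite phiZ// phil// -/(alpha k) -/g -mulrA.
    have -> : s `^ (p - 1) * g = s `^ p * alpha k.
      by rewrite -sg -(mulr_powRB1 s0 p0); ring.
    lra.
  apply: le_trans main.
  apply: (@le_trans _ _ ((c k * (s * alpha k)) `^ p)).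
    apply: ge0_ler_powR; rewrite ?nnegrE ?(ltW p0) ?mulr_ge0 ?powR_ge0//.
    by rewrite /xi normrM ger0_norm ?powR_ge0// ler_wpM2l ?powR_ge0// sg.
  rewrite mulrCA powRM ?mulr_ge0 ?powR_ge0// ler_wpM2l ?powR_ge0//.
  by rewrite cK.
have B_le k u : phi (B k u) <= `|u| `^ p.
  apply: le_trans (phi_delta u); apply: phi_le => //.
    exact: dominated_delta.
  move=> d; have /andP[A0 A1] := A01 k d.
  by rewrite /B ler_piMl ?powR_ge0.
have bound k u : `|xi k u| <= `|u|.
  rewrite leNgt; apply/negP => /(gt0_ltr_powR p0 (normr_ge0 _) (normr_ge0 _)).
  by rewrite ltNge (le_trans (holder k u)).
have /choice[xs xsE] : forall k, exists d : dualSpace E, forall u, d u = xi k u.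
  move=> k; pose xiL := GRing.isLinear.Build R E R *:%R (xi k) (xi_lin k).
  pose xik : {linear E -> R} := HB.pack (xi k) xiL.
  apply: (@dual_of_bounded _ _ xik 1) => u; rewrite mul1r.
  exact: le_trans (ler_norm _) (bound k u).
have sumA h : \sum_k (fun d => A k d * h d) = h.
  apply/funext => d; rewrite fct_sumE (bigD1 (cell d))//= /A eqxx mul1r.
  by rewrite big1 ?addr0// => k /negbTE; rewrite eq_sym => ->; rewrite mul0r.
exists xs; split.
  move=> u u1; under eq_bigr do rewrite xsE.
  apply: (le_trans (ler_sum _ (fun k _ => holder k u))).
  rewrite -phi_sum// sumA; apply: (le_trans (phi_delta u)).
  have <- : 1 `^ p = 1 :> R by rewrite powR1.
  by apply: ge0_ler_powR; rewrite ?nnegrE ?(ltW p0).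
rewrite -[in RHS](sumA (fun d => f d `^ p)) phi_sum//; apply: eq_bigr => k _.
rewrite (fw (k := k)); last first.
  move=> y Sy; rewrite xsE mulr_ge0 ?powR_ge0//; apply: phi_ge0 => // d.
  have /andP[A0 A1] := A01 k d; rewrite /Y.
  have [->|/AE ck] := eqVneq (A k d) 0; first by rewrite mul0r.
  by rewrite !mulr_ge0 ?powR_ge0// (cellP d)// ck.
(* On the cell, [w k] evaluates to [f] itself. *)
have YF : Y k (w k) = F k.
  apply/funext => d; rewrite /Y /F.
  have [->|/AE ck] := eqVneq (A k d) 0; first by rewrite !mul0r.
  rewrite -(fw (k := k)) => [|y]; last by rewrite -ck; exact: cellP.
  by rewrite mulrC -(mulr_powRB1 (f0 d) p0); ring.
rewrite xsE /xi YF -/(alpha k) -/(F k).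
have [ak0|akN0] := eqVneq (alpha k) 0.
  by rewrite ak0 mulr0 normr0 powR0// -/(alpha k) ak0.
by rewrite ger0_norm ?mulr_ge0 ?powR_ge0// cK// lt_def akN0 alpha0.
Qed.

End Averaging.

(** * Domination and the bound on the lift *)

Section Domination.
Context (R : realType) (p : R) (p1 : 1 < p) (E : normedModType R).
Implicit Types (d : dualSpace E) (f : dualSpace E -> R) (A : seq E).

Let p0 : 0 < p. Proof. exact: lt_trans p1. Qed.
Let ev := (@delta R E : {linear E -> (dualSpace E -> R)}).

Lemma lsup_delta_max A d y : y \in A -> (forall z, z \in A -> d z <= d y) ->
  lsup ev A d = d y.
Proof.
move=> yA dy; apply/eqP; rewrite eq_le lsup_delta_le//=; last by case: A yA {dy}.
by have /fun_vleP/(_ d) := @lsup_ge _ _ _ ev A y yA; exact.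
Qed.

Lemma argmax_seq A d : A != [::] ->
  exists i : 'I_(size A), forall z, z \in A -> d z <= d A`_i.
Proof.
move=> A0; have sA : (0 < size A)%N by case: A A0.
have [i _ iP] := @arg_maxP _ _ _ (Ordinal sA) xpredT (fun j => d A`_j) isT.
by exists i => z /(nthP 0)[j jA <-]; exact: (iP (Ordinal jA)).
Qed.

(** The cone of index [(i, j)] is the set of the functionals whose maximum over [A] is
attained at the i-th element and whose maximum over [B] at the j-th. *)
Lemma FBL_gen_linear_on_cells f : FBL_gen f ->
  exists n (S : 'I_n -> set E) (w : 'I_n -> E),
    (forall d, exists k, forall y, S k y -> 0 <= d y) /\
    (forall k d, (forall y, S k y -> 0 <= d y) -> f d = d (w k)).
Proof.
move=> /(lift_exists ev)[_ [A [B [A0 B0 -> _]]]].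
pose I : finType := ('I_(size A) * 'I_(size B))%type.
pose S (k : I) : set E :=
  [set A`_(k.1) - z | z in [set` A]] `|`
  [set B`_(k.2) - z | z in [set` B]].
exists #|I|, (fun k => S (enum_val k)).
exists (fun k => A`_((enum_val k : I).1) - B`_((enum_val k : I).2)).
split=> [d|k d Sd].
  have [i iP] := argmax_seq d A0; have [j jP] := argmax_seq d B0.
  exists (enum_rank (i, j)) => y; rewrite enum_rankK.
  move=> [[z zA <-]|[z zB <-]].
    by rewrite linearB subr_ge0; exact: iP.
  by rewrite linearB subr_ge0; exact: jP.
set i := (enum_val k).1; set j := (enum_val k).2.
rewrite linearB /= [LHS](_ : _ = lsup ev A d - lsup ev B d)//.
rewrite (@lsup_delta_max A d A`_i) ?mem_nth// => [|z zA]; last first.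
  by rewrite -subr_ge0 -linearB; apply: Sd; left; exists z.
rewrite (@lsup_delta_max B d B`_j) ?mem_nth// => z zB.
by rewrite -subr_ge0 -linearB; apply: Sd; right; exists z.
Qed.

(** By contradiction: the gauge of [f ^ p] would be at least [N' ^ p], and averaging
the resulting functional over the cells produces a family on which the l^p-sum
of [f] exceeds [N]. *)
Theorem pietsch_domination f (N N' : R) : FBL_gen f -> (forall d, 0 <= f d) ->
  (Hp_norm p f <= N%:E)%E -> N < N' ->
  exists m (w : 'I_m -> E), (forall d, f d <= lp_sum p (fun k => d (w k))) /\
    lp_sum p (fun k => `|w k|) <= N'.
Proof.
move=> fG f0 fN NN'.
have N0 : 0 <= N by have := le_trans (Hp_norm_ge0 p f) fN; rewrite lee_fin.
have N'0 : 0 <= N' by exact: le_trans (ltW NN').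
have [n [S [w [cover fw]]]] := FBL_gen_linear_on_cells fG.
have [[s [fs sN']]|no_s] := pselect (exists s : seq E,
    (forall d, f d `^ p <= psum p s d) /\ pweight p s <= N' `^ p).
  exists (size s), (fun k => s`_k); split=> [d|].
    rewrite /lp_sum -[leLHS]powRr1// -(mulfV (lt0r_neq0 p0)) powRrM.
    apply: ge0_ler_powR; rewrite ?nnegrE ?invr_ge0 ?(ltW p0) ?powR_ge0//.
      by apply: sumr_ge0 => k _; exact: powR_ge0.
    by apply: (le_trans (fs d)); rewrite /psum (big_nth 0) big_mkord.
  rewrite /lp_sum -[leRHS]powRr1// -(mulfV (lt0r_neq0 p0)) powRrM.
  apply: ge0_ler_powR; rewrite ?nnegrE ?invr_ge0 ?(ltW p0) ?powR_ge0//.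
    by apply: sumr_ge0 => k _; exact: powR_ge0.
  apply: le_trans sN'; rewrite /pweight (big_nth 0) big_mkord.
  by under eq_bigr do rewrite normr_id.
exfalso.
have fdom := @linear_on_cells_dominated _ p _ _ f0 _ _ _ cover fw.
have [|phi [phil phi0 phid phif]] :=
    @pietsch_functional _ _ p1 _ _ (N' `^ p) fdom.
  move=> s fs; rewrite leNgt; apply/negP => /ltW sN'; apply: no_s.
  by exists s.
have [xs [wxs xsE]] := average_over_cells p1 phil phi0 phid f0 cover fw.
have := le_trans (Hp_norm_ge f wxs) fN; rewrite lee_fin => xsN.
have := phif; rewrite -xsE -lp_sum_pow// leNgt => /negP; apply.
apply: (@le_lt_trans _ _ (N `^ p)).
  by apply: ge0_ler_powR; rewrite ?nnegrE ?(ltW p0) ?lp_sum_ge0.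
by apply: gt0_ltr_powR; rewrite ?nnegrE.
Qed.

End Domination.

Section LpSumCalculus.
Context (R : realType) (p : R) (p1 : 1 < p).

Lemma lp_sum_sublinear m : sublinear (@lp_sum R p m).
Proof.
split; last by move=> s t; exact: lp_sumD.
by move=> a t a0; rewrite [LHS]lp_sumZ// ger0_norm.
Qed.

Lemma calc_fun_lp_sum m : calc_fun (fun t : 'rV[R]_m => lp_sum p (t 0)).
Proof.
split; last first.
  move=> a t a0; have [lp_homog _] := lp_sum_sublinear m.
  have <- : a *: (t 0 : 'I_m -> R) = (a *: t) 0.
    by apply/funext => k; rewrite mxE.
  exact: (lp_homog a (t 0) a0).
move=> s; apply/(@cvgrPdist_lt _ R^o _ (nbhs s)) => e e0.
pose C : R := lp_sum p (fun _ : 'I_m => 1).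
have C0 : 0 < C + 1 by rewrite ltr_wpDl// lp_sum_ge0.
have d0 : 0 < e / (C + 1) by rewrite divr_gt0.
apply/nbhs_ballP; exists (e / (C + 1)) => //= t [_ st].
have dist (a b : 'rV[R]_m) : (forall k, `|a 0 k - b 0 k| < e / (C + 1)) ->
    lp_sum p (a 0) - lp_sum p (b 0) < e.
  move=> ab; rewrite ltrBlDr.
  have -> : lp_sum p (a 0) = lp_sum p (fun k => (a 0 k - b 0 k) + b 0 k).
    by congr lp_sum; apply/funext => k; rewrite subrK.
  apply: (le_lt_trans (lp_sumD p1 _ _)); rewrite ltrD2r.
  apply: (@le_lt_trans _ _ (lp_sum p (fun _ : 'I_m => e / (C + 1) * 1))).
    by apply: lp_sum_le => // k; rewrite mulr1 (gtr0_norm d0) ltW.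
  rewrite lp_sumZ// gtr0_norm// -/C mulrAC ltr_pdivrMr// ltr_pM2l//.
  by rewrite ltrDl.
rewrite ltr_norml; apply/andP; split.
  by rewrite ltrNl opprB; apply: dist => k; rewrite distrC; exact: st.
by apply: dist => k; exact: st.
Qed.

End LpSumCalculus.

Section OperatorBound.
Context (R : realType) (p : R) (p1 : 1 < p) (E : normedModType R).
Context (X : banachLatticeType R) (T : {linear E -> X}).

(** The infimum is attained, each bound being a closed condition on the constant. *)
Lemma p_convexity_constantP : p_convex p X ->
  p_convexity_bound p X (p_convexity_constant p X).
Proof.
move=> [M0 M0P].
have lb : has_lbound [set M | p_convexity_bound p X M] by exists 1 => M [].
split; first by apply: lb_le_inf; [exists M0|move=> M []].
move=> m x; have := lp_sum_ge0 p (fun k => `|x k|).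
rewrite le_eqVlt => /predU1P[L0|L0].
  by have [_ /(_ m x)] := M0P; rewrite -L0 !mulr0.
rewrite -ler_pdivrMr//; apply: lb_le_inf; first by exists M0.
by move=> M [_ MP]; rewrite ler_pdivrMr.
Qed.

Lemma opnormP : continuous T -> exists C : R, [/\ 0 <= C,
  opnorm T = C%:E & forall x, `|T x| <= C * `|x|].
Proof.
move=> /linear_bounded_continuous/linear_boundedP/pinfty_ex_gt0[c c0 Tc].
have fin : opnorm T \is a fin_num.
  rewrite ge0_fin_numE.
    apply: (@le_lt_trans _ _ c%:E); last exact: ltry.
    apply: ge_ereal_sup => _ [x /= x1 <-]; rewrite lee_fin.
    by apply: (le_trans (Tc x)); rewrite ler_piMr// ltW.
  by apply: ereal_sup_ubound; exists 0; rewrite /= ?normr0// linear0 normr0.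
have Tball x : `|x| <= 1 -> `|T x| <= fine (opnorm T).
  by move=> x1; rewrite -lee_fin fineK//; apply: ereal_sup_ubound; exists x.
have C0 : 0 <= fine (opnorm T).
  by apply: le_trans (Tball 0 _); rewrite ?normr0.
exists (fine (opnorm T)); split => //; first by rewrite fineK.
move=> x; have [->|x0] := eqVneq x 0; first by rewrite linear0 !normr0 mulr0.
have nx0 : 0 < `|x| by rewrite normr_gt0.
have := Tball (`|x|^-1 *: x); rewrite linearZ !normrZ normfV normr_id.
by rewrite mulVf ?gt_eqF// => /(_ (lexx _)); rewrite ler_pdivrMl// mulrC.
Qed.

Context (M C : R) (MP : p_convexity_bound p X M) (C0 : 0 <= C).
Hypothesis TC : forall x, `|T x| <= C * `|x|.
Context (T0 : (dualSpace E -> R) -> X).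
Hypotheses
  (T0l : forall (a : R) f g, FBL_gen f -> FBL_gen g ->
    T0 (a *: f + g) = a *: T0 f + T0 g)
  (T0j : forall f g, FBL_gen f -> FBL_gen g ->
    T0 (vjoin f g) = vjoin (T0 f) (T0 g))
  (T0le : forall f m (w : 'I_m -> E) (r : ('I_m -> R) -> R) (u : X),
    FBL_gen f -> sublinear r ->
    (forall b, (forall t, \sum_i b i * t i <= r t) ->
      vle (\sum_i b i *: T (w i)) u) ->
    (forall d : dualSpace E, f d <= r (fun k => d (w k))) -> vle (T0 f) u).

(** Passing to [|f|], which has the same norm, puts the domination theorem in force;
the hypothesis [T0le] carries the domination to [X] and p-convexity evaluates it. *)
Theorem lift_norm_le f (e : R) : FBL_gen f -> (Hp_norm p f <= e%:E)%E ->
  `|T0 f| <= M * C * e.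
Proof.
move=> fG fe; have GS := @FBL_gen_sublattice R E.
have M0 : 0 <= M by have [M1 _] := MP; exact: le_trans M1.
have MC0 : 0 <= M * C by rewrite mulr_ge0.
have absG : FBL_gen (vabs f) by exact: (sublattice_abs GS).
have abs_ge0 d : 0 <= vabs f d by rewrite vabs_funE.
have abse : (Hp_norm p (vabs f) <= e%:E)%E.
  apply: le_trans fe; apply: (Hp_norm_mono p1) => d.
  by rewrite vabs_funE normr_id.
have step e' : e < e' -> `|T0 f| <= M * C * e'.
  move=> ee'.
  have [m [w [fw we']]] := pietsch_domination p1 absG abs_ge0 abse ee'.
  have := T0le (u := calculus (T \o w) (fun t => lp_sum p (t 0))) absG
    (lp_sum_sublinear p1 m) _ fw.
  rewrite (hom_on_abs GS T0l T0j)//.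
  have H b : (forall t, \sum_i b i * t i <= lp_sum p t) ->
      vle (\sum_i b i *: T (w i)) (calculus (T \o w) (fun t => lp_sum p (t 0))).
    move=> bp; apply: (calculus_linear_le (T \o w)).
      exact: calc_fun_lp_sum.
    by move=> t; exact: bp.
  move=> /(_ H)/norm_le_abs/le_trans; apply.
  have [_ MX] := MP; apply: (le_trans (MX _ _)); rewrite -mulrA ler_wpM2l//.
  apply: (@le_trans _ _ (lp_sum p (fun k => C * `|w k|))).
    apply: lp_sum_le => // k; rewrite normr_id ger0_norm ?mulr_ge0//.
    exact: TC.
  by rewrite lp_sumZ// ger0_norm// ler_wpM2l.
apply/ler_addgt0Pr => d d0.
have MC1 : 0 < M * C + 1 by rewrite ltr_wpDl.
have := step (e + d / (M * C + 1)); rewrite ltrDl divr_gt0// => /(_ isT).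
move=> /le_trans; apply; rewrite mulrDr lerD2l mulrCA ler_piMr ?(ltW d0)//.
by rewrite ler_pdivrMr// mul1r lerDl.
Qed.

End OperatorBound.

(** * Automatic continuity and the universal property *)

Section AutomaticContinuity.
Context (R : realType) (V : banachLatticeType R) (W : normedLatticeType R).

(** The negative part is a Lipschitz function that vanishes at every [u >= 0]. *)
Lemma vle0_closed (l : V) :
  (forall e, 0 < e -> exists2 u, vle 0 u & `|l - u| < e) -> vle 0 l.
Proof.
move=> lu; rewrite -vle_oppE oppr0.
suff <- : vjoin (- l) 0 = 0 by exact: vle_joinl.
apply: (@eq_norm_small _ _ 1) => e e0; have [u u0 lue] := lu e e0.
have uE : vjoin (- u) 0 = 0.
  by apply: vle_anti; rewrite vle_joinr andbT vjoin_le vle_refl andbT -vle_oppE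
    opprK oppr0.
rewrite -{2}uE mul1r; apply: (le_trans (norm_vjoinB _ _ _ _)).
by rewrite subrr normr0 addr0 -opprD normrN ltW.
Qed.

(** The gliding hump: if [S] is unbounded there are [y_n >= 0] with
[|y_n| = 2 ^ - n] and [|S y_n| > n].  Their sum [z] satisfies [y_n <= z], so
[|S z| > n] for all [n]. *)
Theorem lattice_hom_bounded (S : V -> W) : lattice_hom S ->
  exists c, forall x, `|S x| <= c * `|x|.
Proof.
move=> [Sl _ Sj]; apply: contrapT => /forallNP unb.
have TS : @sublattice R V setT by split.
have SlT (a : R) f g : setT f -> setT g -> S (a *: f + g) = a *: S f + S g.
  by move=> _ _; exact: Sl.
have SjT f g : setT f -> setT g -> S (vjoin f g) = vjoin (S f) (S g).
  by move=> _ _; exact: Sj.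
have /choice[x xP] (n : nat) : exists x, n%:R * 2 ^+ n * `|x| < `|S x|.
  by have /existsNP[x /negP] := unb (n%:R * 2 ^+ n); rewrite -ltNge; exists x.
have x0 n : 0 < `|x n|.
  rewrite normr_gt0; apply/eqP => xn0; have := xP n.
  by rewrite xn0 (hom_on0 TS SlT) !normr0 mulr0 ltxx.
pose a n : R := (2 ^+ n * `|x n|)^-1.
have a0 n : 0 < a n by rewrite invr_gt0 mulr_gt0// exprn_gt0.
pose y n := a n *: vabs (x n).
have y0 n : vle 0 (y n).
  by rewrite -(scaler0 V (a n)); apply: vle_scale; [exact: ltW|exact: vabs_ge0].
have yn n : `|y n| = 2^-1 ^+ n.
  rewrite normrZ norm_vabs gtr0_norm// /a invfM exprVn mulfVK//.
  by rewrite gt_eqF.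
have Sy n : n%:R < `|S (y n)|.
  rewrite (hom_onZ TS SlT)// (hom_on_abs TS SlT SjT)// normrZ norm_vabs.
  rewrite gtr0_norm//.
  by rewrite /a ltr_pdivlMl ?mulr_gt0 ?exprn_gt0// mulrC mulrA; exact: xP.
have : cvgn (series y).
  apply: normed_cvg; rewrite (_ : [normed series y] = series (geometric 1 2^-1)).
    by apply: is_cvg_geometric_series; rewrite ger0_norm// invf_lt1// ltr1n.
  apply/funext => n; rewrite /series /=; apply: eq_bigr => k _.
  by rewrite yn mul1r.
move=> /cvg_ex[z zy].
have sum_ge0 n n' : vle 0 (\sum_(n <= k < n') y k).
  apply: (big_ind (vle 0)) => //; first exact: vle_refl.
  by move=> u v u0 v0; rewrite -(addr0 0); exact: vle_add.
have yz n : vle (y n) z.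
  rewrite -(add0r (y n)) -vle_subr; apply: vle0_closed => e e0.
  move/cvgrPdist_lt : zy => /(_ _ e0)[N _ NP].
  exists (series y (maxn N n.+1) - y n).
    rewrite vle_subr add0r /series /= (big_cat_nat (leq0n n.+1) (leq_maxr _ _)).
    rewrite big_nat_recr//=; apply: (@vle_trans _ _ (0 + y n + 0)).
      by rewrite add0r addr0 vle_refl.
    apply: vle_add; last exact: sum_ge0.
    by apply: vle_add; [exact: sum_ge0|exact: vle_refl].
  rewrite opprB addrA subrK; apply: NP; exact: leq_maxl.
have Sz n : n%:R <= `|S z|.
  apply: (le_trans (ltW (Sy n))); apply: norm_le_abs.
  by rewrite -(hom_on_abs TS SlT SjT)// vabs_id//; apply: (hom_on_le SjT).
have := archi_boundP (normr_ge0 (S z)).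
by rewrite ltNge Sz.
Qed.

End AutomaticContinuity.

Theorem theorem6p1 (R : realType) (p : R) (p1 : 1 < p)
    (E : completeNormedModType R) (X : banachLatticeType R) (hX : p_convex p X)
    (T : {linear E -> X}) (hT : continuous T) :
  exists That : FBL p1 E -> X,
    [/\ lattice_hom That,
        That \o @FBL_delta R p p1 E = T,
        forall S : FBL p1 E -> X,
          lattice_hom S -> S \o @FBL_delta R p p1 E = T -> S = That &
        (opnorm That <= (p_convexity_constant p X)%:E * opnorm T)%E].
Proof.
have MP := p_convexity_constantP hX; set M := p_convexity_constant p X in MP *.
have M0 : 0 <= M by have [M1 _] := MP; exact: le_trans M1.
have [C [C0 -> TC]] := opnormP hT.
have [T0 [T0l T0j T0d T0le]] := free_vector_lattice T.
have GS := @FBL_gen_sublattice R E.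
pose small e (f : dualSpace E -> R) : Prop := (Hp_norm p f <= e%:E)%E.
have small0 e : 0 < e -> small e 0.
  by move=> e0; rewrite /small Hp_norm0// lee_fin ltW.
have smallD (a : R) e e' f f' h : small e f -> small e' f' ->
    (forall d, `|h d| <= `|a| * `|f d| + `|f' d|) -> small (`|a| * e + e') h.
  move=> fe f'e' hff'; apply: (le_trans (Hp_norm_comb p1 hff')).
  by rewrite EFinD EFinM; apply: leeD => //; apply: lee_wpmul2l; rewrite ?lee_fin.
have MC0 : 0 <= M * C by rewrite mulr_ge0.
have [T1 [T1T0 T1l T1j T1le]] := extend_by_density GS T0l T0j small0 smallD
  MC0 (fun e f fG => lift_norm_le p1 MP C0 TC T0l T0j T0le (e := e) fG).
have approx (f : FBL p1 E) : approximable (@FBL_gen R E) small (val f).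
  move=> e e0; have /set_mem[_ /(_ _ e0)[g gG fg]] := valP f.
  by exists g => //; exact: ltW.
pose That (f : FBL p1 E) : X := T1 (val f).
have TS : @sublattice R (FBL p1 E) setT by split.
have Thatl (a : R) (f g : FBL p1 E) : That (a *: f + g) = a *: That f + That g.
  by rewrite -T1l.
have Thatj (f g : FBL p1 E) : That (vjoin f g) = vjoin (That f) (That g).
  by rewrite -T1j.
have That_hom : lattice_hom That.
  split => // f g.
  exact: (hom_on_meet TS (fun a f g _ _ => Thatl a f g)
    (fun f g _ _ => Thatj f g)).
have That_delta : That \o @FBL_delta R p p1 E = T.
  apply/funext => x; rewrite /That /= T1T0 ?T0d//; exact: FBL_gen_delta.
exists That; split => //; last first.
  apply: ge_ereal_sup => _ [f /= f1 <-]; rewrite -EFinM lee_fin.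
  apply: (@le_trans _ _ (M * C * `|f|)); last by rewrite ler_piMr.
  by apply: T1le => //; rewrite /small -FBL_normE.
move=> S S_hom Sdelta; apply/funext => f.
have hom0 (U : FBL p1 E -> X) : lattice_hom U -> U 0 = 0.
  by move=> [Ul _ _]; apply: (hom_on0 TS (fun a f g _ _ => Ul a f g)).
(* Carrying a lift [G] of [g] along the generation shows at the same time that [g]
   lies in the free lattice and that the two homomorphisms agree there. *)
have agree g : FBL_gen g -> exists2 G : FBL p1 E, val G = g & S G = That G.
  have [Sl Sm Sj] := S_hom; have [_ Thatm _] := That_hom.
  move=> gG; apply: (gG [set g | exists2 G : FBL p1 E, val G = g & S G = That G]).
  split; last first.
    move=> _ [x _ <-]; exists (FBL_delta p1 x) => //.
    exact: (congr1 (fun F => F x) (etrans Sdelta (esym That_delta))).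
  split.
  - by exists 0; rewrite ?hom0.
  - move=> a g1 g2 [G1 <- SG1] [G2 <- SG2]; exists (a *: G1 + G2) => //.
    by rewrite Sl Thatl SG1 SG2.
  - move=> g1 g2 [G1 <- SG1] [G2 <- SG2]; exists (vmeet G1 G2) => //.
    by rewrite Sm Thatm SG1 SG2.
  - move=> g1 g2 [G1 <- SG1] [G2 <- SG2]; exists (vjoin G1 G2) => //.
    by rewrite Sj Thatj SG1 SG2.
have [c Sc] := lattice_hom_bounded S_hom.
have [c' Tc] := lattice_hom_bounded That_hom.
apply: (@eq_norm_small _ _ (`|c| + `|c'|)) => e e0.
have [g gG fg] := approx f e e0; have [G Gg SG] := agree g gG.
have fG : `|f - G| <= e.
  by move: fg; rewrite /small -Gg -lee_fin [`|_|%:E]FBL_normE.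
have subE (U : FBL p1 E -> X) : lattice_hom U -> U (f - G) = U f - U G.
  by move=> [Ul _ _]; rewrite -scaleN1r addrC Ul scaleN1r addrC.
have -> : S f - That f = S (f - G) - That (f - G).
  by rewrite !subE// SG opprB addrA subrK.
apply: (le_trans (ler_normB _ _)); rewrite mulrDl; apply: lerD.
  apply: (le_trans (Sc _)); apply: (@le_trans _ _ (`|c| * `|f - G|)).
    by rewrite ler_wpM2r// ler_norm.
  by rewrite ler_wpM2l.
apply: (le_trans (Tc _)); apply: (@le_trans _ _ (`|c'| * `|f - G|)).
  by rewrite ler_wpM2r// ler_norm.
by rewrite ler_wpM2l.
Qed.
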